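(* Let $d\ge 1$ and assume $0<s\le1$ and $1<p<\infty$. For any $M>0$, there exist $f,g\in\mathcal S(\mathbb R^d)$ such that $$\|J^sf\|_p+\|g\|_{\mathrm{BMO}}\le1,$$ but $$\|J^s(fg)-fJ^sg\|_p>M.$$
   Context: $\mathcal S(\mathbb R^d)$ is the space of Schwartz functions, $\|\cdot\|_p$ the $L^p(\mathbb R^d)$ norm. $J^s=(1-\Delta)^{s/2}$ is the Fourier multiplier with symbol $(1+|\xi|^2)^{s/2}$. The BMO norm is $\|u\|_{\mathrm{BMO}}=\sup_Q\frac1{|Q|}\int_Q|u-u_Q|\,dy$ ($u_Q$ the average over $Q$, supremum over all cubes $Q\subset\mathbb R^d$). *)

(* Defs.v *)
From HB Require Import structures.
From mathcomp Require Import all_boot all_order all_algebra.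
From mathcomp Require Import all_classical all_reals all_analysis.
From mathcomp Require Import complex.
Set Implicit Arguments.
Unset Strict Implicit.
Unset Printing Implicit Defensive.
Import Order.TTheory GRing.Theory Num.Theory.
Import numFieldNormedType.Exports.
Local Open Scope classical_set_scope.
Local Open Scope ring_scope.
Local Open Scope complex_scope.

(* MathComp-Analysis has Lebesgue measure on the line and binary products of
   measures only.  Lebesgue measure on R^n is built here by iterating the
   product, on the measurable type n.-tuple R of the library (whose
   sigma-algebra is the one generated by the coordinates, i.e. Borel).
   [leb_box] checks the normalisation. *)
Section lebesgue_Rn.
Context {R : realType}.
Local Notation mR := (measurableTypeR R).

Definition tcons n (xt : mR * n.-tuple mR) : n.+1.-tuple mR :=
  [tuple of xt.1 :: xt.2].

Lemma measurable_tcons n : measurable_fun [set: mR * n.-tuple mR] (@tcons n).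
Proof. exact: measurable_cons. Qed.

Section step.
Variables (n : nat) (m : {sigma_finite_measure set (n.-tuple mR) -> \bar R}).

Definition leb_step : set (n.+1.-tuple mR) -> \bar R :=
  pushforward (lebesgue_measure \x m)%E (@tcons n).

Let leb_step0 : leb_step set0 = 0%E.
Proof. by rewrite /leb_step /pushforward preimage_set0 measure0. Qed.

Let leb_step_ge0 A : (0 <= leb_step A)%E.
Proof. exact: (measure_ge0 (lebesgue_measure \x m)%E). Qed.

Let leb_step_sigma_additive : semi_sigma_additive leb_step.
Proof.
move=> F mF tF mUF; rewrite /leb_step /pushforward preimage_bigcup.
have mT (B : set (n.+1.-tuple mR)) : measurable B -> measurable (@tcons n @^-1` B).
  by move=> mB; rewrite -[X in measurable X]setTI; exact: measurable_tcons.
apply: measure_semi_sigma_additive.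
- by move=> k; exact: mT.
- apply/trivIsetP => /= i j _ _ ij; rewrite -preimage_setI.
  by move/trivIsetP : tF => /(_ _ _ _ _ ij) ->//; rewrite preimage_set0.
- by rewrite -preimage_bigcup; exact: mT.
Qed.

HB.instance Definition _ := isMeasure.Build _ _ _ leb_step
  leb_step0 leb_step_ge0 leb_step_sigma_additive.

Let leb_step_sigma_finite : sigma_finite setT leb_step.
Proof.
have /sigma_finiteP[F [TF ndF Foo]] := sigma_finiteT (@lebesgue_measure R).
have /sigma_finiteP[G [TG ndG Goo]] := sigma_finiteT m.
exists (fun k => [set t | F k (thead t) /\ G k [tuple of behead t]]).
  apply/seteqP; split => // t _.
  have [i _ Fi] : (\bigcup_k F k) (thead t) by rewrite -TF.
  have [j _ Gj] : (\bigcup_k G k) [tuple of behead t] by rewrite -TG.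
  exists (maxn i j) => //; split.
  - by move: Fi; exact/subsetPset/ndF/leq_maxl.
  - by move: Gj; exact/subsetPset/ndG/leq_maxr.
move=> k; have [mF Fk] := Foo k; have [mG Gk] := Goo k; split.
  rewrite [X in measurable X](_ : _ =
    ((fun t : n.+1.-tuple mR => tnth t ord0) @^-1` F k) `&`
    ((fun t : n.+1.-tuple mR => [tuple of behead t] : n.-tuple mR) @^-1` G k))//.
  apply: measurableI.
  - by rewrite -[X in measurable X]setTI; exact: measurable_tnth.
  - by rewrite -[X in measurable X]setTI; exact: measurable_behead.
rewrite /leb_step /pushforward.
rewrite [X in (_ \x _)%E X](_ : _ = F k `*` G k).
  by rewrite product_measure1E// lte_mul_pinfty// ge0_fin_numE.
have bE x (t : n.-tuple mR) : [tuple of behead (tcons (x, t))] = t :> n.-tuple mR.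
  exact: val_inj.
by apply/seteqP; split => -[x t]; rewrite /preimage /= bE.
Qed.

HB.instance Definition _ := Measure_isSigmaFinite.Build _ _ _ leb_step
  leb_step_sigma_finite.

End step.

Fixpoint leb n : {sigma_finite_measure set (n.-tuple mR) -> \bar R} :=
  match n with
  | 0 => \d_([tuple] : 0.-tuple mR)
  | k.+1 => leb_step (leb k)
  end.

Lemma leb_box n (a b : 'I_n -> R) : (forall i, a i <= b i) ->
  leb n [set t | forall i, tnth t i \in `[a i, b i]] =
  (\prod_(i < n) (b i - a i))%:E.
Proof.
elim: n a b => [|n IHn] a b ab.
  by rewrite big_ord0 /= diracE mem_set//= => -[].
rewrite big_ord_recl /= /leb_step /pushforward.
rewrite [X in (_ \x _)%E X](_ : _ = `[a ord0, b ord0] `*`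
   [set t | forall i, tnth t i \in `[a (lift ord0 i), b (lift ord0 i)]]); last first.
  apply/seteqP; split => -[x t] /=.
    move=> h; split; first by have := h ord0; rewrite tnth0.
    by move=> i; have := h (lift ord0 i); rewrite tnthS.
  by move=> [h0 h] i; case: (unliftP ord0 i) => [j ->|->]; rewrite ?tnthS ?tnth0.
rewrite product_measure1E//.
- rewrite (IHn (a \o lift ord0) (b \o lift ord0))//= EFinM; congr (_ * _)%E.
  transitivity (lebesgue_measure (`[a ord0, b ord0]%classic : set R)) => //.
  rewrite lebesgue_measure_itv/= lte_fin.
  by have := ab ord0; case: ltgtP => // -> _; rewrite subrr.
- rewrite [X in measurable X](_ : _ = \bigcap_(i in [set: 'I_n])
     ((fun t : n.-tuple mR => tnth t i) @^-1` `[a (lift ord0 i), b (lift ord0 i)])).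
    apply: fin_bigcap_measurable => // i _.
    rewrite -[X in measurable X]setTI.
    by apply: (@measurable_tnth _ mR n i) => //; exact: measurable_itv.
  by apply/seteqP; split => t /= h i; [move=> _|]; exact: h.
Qed.

End lebesgue_Rn.

Section Rd.
Context {R : realType} {d : nat}.
Local Notation Rd := 'rV[R]_d.
Local Notation C := R[i].

(* Identifies the measurable space d.-tuple R with the normed space 'rV[R]_d. *)
Definition vec (t : d.-tuple (measurableTypeR R)) : Rd :=
  \row_(i < d) (tnth t i : R).

Definition cmod (z : C) : R := ComplexField.Normc.normc z.

Definition cintegral (D : set Rd) (F : Rd -> C) : C :=
  (\int[leb d]_(t in vec @^-1` D) complex.Re (F (vec t)))%R +i*
  (\int[leb d]_(t in vec @^-1` D) complex.Im (F (vec t)))%R.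

Definition Lpnorm (p : R) (F : Rd -> C) : \bar R :=
  Lnorm (leb d) p%:E (fun t => (cmod (F (vec t)))%:E).

Definition partial (i : 'I_d) (F : Rd -> C) : Rd -> C := fun x =>
  ('D_(delta_mx 0 i) (@complex.Re R \o F : Rd -> R) x) +i*
  ('D_(delta_mx 0 i) (@complex.Im R \o F : Rd -> R) x).

Definition partials (s : seq 'I_d) (F : Rd -> C) : Rd -> C := foldr partial F s.

(* Differentiability of every iterated partial derivative makes all of them
   continuous, so this is C^infty; C-valued maps are differentiated through
   their real and imaginary parts. *)
Definition smooth (F : Rd -> C) := forall (s : seq 'I_d) (x : Rd),
  differentiable (@complex.Re R \o partials s F : Rd -> R) x /\
  differentiable (@complex.Im R \o partials s F : Rd -> R) x.

Definition monomial (a : 'I_d -> nat) (x : Rd) : R := \prod_(i < d) x 0 i ^+ a i.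

Definition schwartz (F : Rd -> C) := smooth F /\
  forall (a : 'I_d -> nat) (s : seq 'I_d), exists K : R, forall x : Rd,
    cmod ((monomial a x)%:C * partials s F x) <= K.

Definition dot (x y : Rd) : R := \sum_(i < d) x 0 i * y 0 i.

Definition cis (t : R) : C := cos t +i* sin t.

(* Convention without 2 * pi in the phase, so that -Delta has symbol |xi|^2. *)
Definition fourier (F : Rd -> C) (xi : Rd) : C :=
  cintegral setT (fun x => F x * cis (- dot x xi)).

Definition inv_fourier (G : Rd -> C) (x : Rd) : C :=
  (((2 * pi) ^- d)%R)%:C * cintegral setT (fun xi => G xi * cis (dot x xi)).

Definition fourier_multiplier (m : Rd -> R) (F : Rd -> C) : Rd -> C :=
  inv_fourier (fun xi => (m xi)%:C * fourier F xi).

(* dot xi xi is the squared Euclidean norm; the library norm on 'rV is the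
   sup norm. *)
Definition bessel (s : R) : (Rd -> C) -> Rd -> C :=
  fourier_multiplier (fun xi => (1 + dot xi xi) `^ (s / 2)).

Definition cube (a : Rd) (l : R) : set Rd :=
  [set x | forall i, x 0 i \in `[a 0 i, a 0 i + l]].

Definition volume (Q : set Rd) : R := fine (leb d (vec @^-1` Q)).

Definition average (Q : set Rd) (u : Rd -> C) : C :=
  ((volume Q)^-1)%:C * cintegral Q u.

Definition BMO_norm (u : Rd -> C) : \bar R := ereal_sup
  [set (((volume Q)^-1)%:E *
        \int[leb d]_(t in vec @^-1` Q) (cmod (u (vec t) - average Q u))%:E)%E
  | Q in [set cube a l | a in [set: Rd] & l in [set l : R | 0 < l]]].

End Rd.

(* Main.v *)
Require Import Defs.
From HB Require Import structures.
From mathcomp Require Import all_boot all_order all_algebra.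
From mathcomp Require Import all_classical all_reals all_analysis.
From mathcomp Require Import measurable_realfun complex ring lra.
Set Implicit Arguments.
Unset Strict Implicit.
Unset Printing Implicit Defensive.
Import Order.TTheory GRing.Theory Num.Theory.
Import numFieldNormedType.Exports.
Local Open Scope classical_set_scope.
Local Open Scope ring_scope.
Local Open Scope complex_scope.

(** Bessel potentials fix constants: J^s c = c.  So where g is close to a large
    constant c on the region where f lives, J^s(fg) - f J^s g is close to
    c (J^s f - f), which is not small.  The BMO norm ignores constants and
    tolerates logarithmic growth, hence does not prevent such a g.

    Write G_b(x) = exp(-b |x|^2 / 2).  The witnesses are a small multiple of G_1
    for f and a small multiple of the sum over k < N of the dilates G_b,
    b = 4^-k, for g.  The value of that sum at 0 is N, whereas its BMO norm is
    bounded independently of N: on a cube of side l the k-th term has mean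
    oscillation at most a constant times min(y, 1/y) with y = 2^-k l, by a
    Lipschitz bound on small cubes and a bound on the mean on large ones, and
    these minima have a bounded sum over k (gmean_dev, saturation_telescope,
    BMO_gauss_sum).

    Everything else is explicit because Gaussians are stable under the heat
    flow.  For 0 < sigma < 1 the power lambda^sigma is a constant multiple of the
    integral over t > 0 of (1 - exp(-lambda t)) t^(-1-sigma) dt
    (integral_subord_kernel).  With sigma = s/2 and lambda = 1 + |xi|^2 this
    writes J^s h as an average over t of h - e^-t e^(t Delta) h.  For h = G_b
    both terms are Gaussians, whence a formula for J^s of a finite sum of
    Gaussians as an integral over a half-line (symbol_formula,
    bessel_gauss_sum).  Two estimates are read off it.

    In the commutator the terms fg cancel, and what remains is the average of
    e^-t (f e^(t Delta) g - e^(t Delta) (fg)).  For f = G_1 and g = G_eps with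
    eps <= 1 the integrand is nonnegative on |x|^2 <= d/4 and its integral is at
    least a constant independent of eps (heat_gap, bessel_gauss_gap).  The N
    terms of g therefore add up on the unit cube centred at 0, and the
    commutator is at least a constant times N there.

    For the normalisation of f, the integrand in the formula for J^s G_1 is at
    most a constant times 1 - e^-t times the product of the 1 / (1 + x_i^2)
    (gauss_sub_heat, heat_sub_gauss), so a multiple of this product bounds J^s G_1,
    and it lies in L^p. *)

(** * Gaussian and Cauchy integrals on the line *)

Section line.
Context {R : realType}.
Local Notation mu := (@lebesgue_measure R).

Lemma is_derive_affine (a c x : R) :
  is_derive x 1 (fun x : R => c * x + a) c.
Proof. by apply: is_derive_eq; rewrite /GRing.scale/=; ring. Qed.

(** Used with a = 0 to normalise Gaussians and with c = 1 in the subordination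
    formula, where scaling becomes a translation of the logarithmic variable. *)
Lemma integral_affine (a c : R) (G : R -> R) : 0 < c -> continuous G ->
  (forall x, 0 <= G x) ->
  (\int[mu]_x (G x)%:E = c%:E * \int[mu]_x (G (c * x + a))%:E)%E.
Proof.
move=> c0 cG G0.
have dF : derive1 (fun x : R => c * x + a) = cst c.
  by apply/funext => x; rewrite derive1E; case: (is_derive_affine a c x).
rewrite (@increasing_ge0_integration_by_substitutionT _ (fun x => c * x + a))//=.
- rewrite dF -ge0_integralZl//=.
  + by apply: eq_integral => x _; rewrite /= -EFinM mulrC.
  + apply/measurable_EFinP/measurableT_comp; first exact: continuous_measurable_fun.
    apply: measurable_funD => //; exact: measurable_funM.
  + by move=> x _; rewrite lee_fin.
  + by rewrite lee_fin ltW.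
- by move=> x y xy; rewrite ltrD2r ltr_pM2l.
- by rewrite dF => x; exact: cvg_cst.
- by rewrite dF; exact: is_cvg_cst.
- by rewrite dF; exact: is_cvg_cst.
- apply/cvgrNyPle => A; near=> x.
  rewrite -lerBrDr -ler_pdivlMl//; near: x; exact: nbhs_ninfty_le.
- apply/cvgryPge => A; near=> x.
  rewrite -lerBlDr -ler_pdivrMl//; near: x; exact: nbhs_pinfty_ge.
Unshelve. all: by end_near. Qed.

Definition gauss1 (b x : R) : R := expR (- (b / 2) * x ^+ 2).

Lemma gauss1_ge0 b x : 0 <= gauss1 b x.
Proof. exact: expR_ge0. Qed.

Lemma continuous_gauss1 b : continuous (gauss1 b).
Proof.
move=> x; apply: continuous_comp; last exact: continuous_expR.
by apply: cvgM; [exact: cvg_cst|exact: exprn_continuous].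
Qed.

Lemma measurable_gauss1 b : measurable_fun [set: measurableTypeR R] (gauss1 b).
Proof. by apply: continuous_measurable_fun; exact: continuous_gauss1. Qed.

Lemma integral_gauss1 b : 0 < b ->
  (\int[mu]_x (gauss1 b x)%:E = (Num.sqrt (2 * pi / b))%:E)%E.
Proof.
move=> b0.
have b2 : 0 < b / 2 by rewrite divr_gt0.
have sb : 0 < Num.sqrt (b / 2) by rewrite sqrtr_gt0.
have := @integralT_gauss R.
rewrite (@integral_affine 0 _ _ sb); last 2 first.
- exact: continuous_gauss_fun.
- exact: gauss_fun_ge0.
rewrite (_ : (fun x => _) = (fun x => (gauss1 b x)%:E)); last first.
  apply/funext => x; rewrite /gauss_fun /gauss1 addr0 exprMn sqr_sqrtr ?ltW//.
  by rewrite mulNr.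
move=> h.
have : ((Num.sqrt (b / 2))^-1%:E * (Num.sqrt pi)%:E = (Num.sqrt (2 * pi / b))%:E)%E.
  rewrite -EFinM -sqrtrV ?ltW// -sqrtrM ?invr_ge0 ?ltW//.
  by congr (Num.sqrt _)%:E; rewrite invf_div mulrAC.
by rewrite -h muleA -EFinM mulVf ?mul1e// gt_eqF.
Qed.

Lemma integrable_gauss1 b : 0 < b -> mu.-integrable setT (EFin \o gauss1 b).
Proof.
move=> b0; apply/integrableP; split.
  by apply/measurable_EFinP; exact: measurable_gauss1.
under eq_integral do rewrite /= ger0_norm ?gauss1_ge0//.
by rewrite integral_gauss1// ltry.
Qed.

Lemma dominated_integrable d (T : measurableType d)
  (m : {measure set T -> \bar R}) (f g : T -> R) :
  measurable_fun setT f -> m.-integrable setT (EFin \o g) ->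
  (forall x, `|f x| <= g x) -> m.-integrable setT (EFin \o f).
Proof.
move=> mf ig fg; apply: (le_integrable _ _ _ ig) => //.
  exact/measurable_EFinP.
by move=> x _ /=; rewrite lee_fin (le_trans (fg _))// ler_norm.
Qed.

Lemma integrable_oneDsqrV :
  mu.-integrable setT (EFin \o (fun x : R => (1 + x ^+ 2)^-1)).
Proof.
have c : continuous (fun x : R => (1 + x ^+ 2)^-1).
  exact: continuous_oneDsqrV.
apply/integrableP; split.
  by apply/measurable_EFinP; exact: continuous_measurable_fun.
have p x : 0 <= (1 + x ^+ 2)^-1 :> R.
  by rewrite invr_ge0 addr_ge0// sqr_ge0.
under eq_integral do rewrite /= ger0_norm//.
rewrite (@ge0_symfun_integralT _ (fun x => (1 + x ^+ 2)^-1))//; last first.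
  by move=> x/=; rewrite sqrrN.
rewrite (_ : [set x | _] = `[0, +oo[%classic); last first.
  by apply/seteqP; split => x/=; rewrite in_itv/= andbT.
by rewrite integral0y_oneDsqr -EFinM ltry.
Qed.

End line.

(** * Fourier transform of the Gaussian on the line *)
Section fourier1.
Context {R : realType}.
Local Notation mu := (@lebesgue_measure R).

Lemma is_derive_continuous (H : R -> R) (dH x : R) :
  is_derive x (1 : R) H dH -> {for x, continuous H}.
Proof.
by case=> Hx _; apply/differentiable_continuous/derivable1_diffP.
Qed.

(** The fundamental theorem of calculus on [-n, n], passed to the limit by
    dominated convergence; the even majorant e makes both boundary terms vanish
    together. *)
Lemma Rintegral_derivative0 (H h e : R -> R) :
  (forall x, is_derive x (1 : R) H (h x)) -> continuous h ->
  mu.-integrable setT (EFin \o h) ->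
  (forall x, `|H x| <= e x) -> (forall x, e (- x) = e x) ->
  e n.+1%:R @[n --> \oo] --> 0 ->
  (\int[mu]_x (h x))%R = 0.
Proof.
move=> dH ch ih He eN e0.
have cH x : {for x, continuous H} by exact: is_derive_continuous (dH x).
have mh : measurable_fun [set: measurableTypeR R] h.
  exact: continuous_measurable_fun.
pose I n : set R := [set` `[- n.+1%:R, n.+1%:R]].
pose hn (n : nat) := (EFin \o h) \_ (I n).
have hnE n : (\int[mu]_x hn n x = (H n.+1%:R - H (- n.+1%:R))%:E)%E.
  rewrite /hn -integral_mkcond EFinB.
  apply: continuous_FTC2.
  - by rewrite -subr_gt0 opprK addr_gt0.
  - exact: continuous_subspaceT.
  - split=> [x _||]; first by case: (dH x).
    + by apply: cvg_at_right_filter; exact: cH.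
    + by apply: cvg_at_left_filter; exact: cH.
  - by move=> x _; rewrite derive1E; case: (dH x).
have mhn n : measurable_fun setT (hn n).
  apply/(measurable_restrictT _ _).1 => //; first exact: measurable_itv.
  by apply: measurable_funTS; exact/measurable_EFinP.
have hn_h x : hn ^~ x @ \oo --> (h x)%:E.
  apply: cvg_near_cst; near=> n.
  rewrite /hn patchE mem_set// /I/= in_itv/= -ler_norml.
  have : `|x| <= n%:R by near: n; exact: nbhs_infty_ger.
  by move/le_trans; apply; rewrite ler_nat.
have [_ _] : [/\ mu.-integrable setT (EFin \o h),
  [sequence \int[mu]_x `|hn n x - (h x)%:E|]_n @ \oo --> 0 &
  [sequence \int[mu]_x (hn n x)]_n @ \oo --> \int[mu]_x (h x)%:E]%E.
  apply: (@dominated_convergence _ _ _ mu setT measurableT hn (EFin \o h)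
     (fun x => `|(h x)%:E|)%E) => //.
  - exact/measurable_EFinP.
  - by apply/aeW => x _; exact: hn_h.
  - exact: integrable_abse ih.
  - apply/aeW => x n _; rewrite /hn patchE; case: ifPn => //= _.
    by rewrite normr0 lee_fin.
rewrite (_ : [sequence _]_n = (fun n => (H n.+1%:R - H (- n.+1%:R))%:E)); last first.
  by apply/funext => n /=; rewrite hnE.
have c0 : H n.+1%:R - H (- n.+1%:R) @[n --> \oo] --> 0.
  apply: norm_cvg0.
  have c2 : 2 * e n.+1%:R @[n --> \oo] --> 0.
    by rewrite -[X in _ --> X](mulr0 2); apply: cvgM => //; exact: cvg_cst.
  apply: (squeeze_cvgr _ (cvg_cst 0) c2); near=> n.
  rewrite normr_ge0/= (le_trans (ler_normB _ _))// mulr2n mulrDl !mul1r lerD//.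
  by rewrite -(eN n.+1%:R).
move=> ch0.
have ch1 : (fun n => (H n.+1%:R - H (- n.+1%:R))%:E) @ \oo --> 0%:E.
  by apply/cvg_EFin => //; exact: nearW.
by rewrite /Rintegral -(cvg_unique _ ch1 ch0).
Unshelve. all: by end_near. Qed.
End fourier1.

Section gaussian_cos.
Context {R : realType}.
Local Notation mu := (@lebesgue_measure R).

Lemma is_derive_gauss1 (b x : R) :
  is_derive x (1 : R) (gauss1 b) (- (b * x * gauss1 b x)).
Proof.
have -> : gauss1 b = expR \o (fun x : R => - (b / 2) * x ^+ 2) by [].
have dg : is_derive x (1 : R) (fun x : R => - (b / 2) * x ^+ 2) (- (b * x)).
  by apply: is_derive_eq; rewrite /GRing.scale/=; field.
by apply: is_derive_eq; rewrite /GRing.scale/= mulrN mulrC.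
Qed.

Lemma is_derive_phase (a s x : R) :
  is_derive x (1 : R) (fun x : R => a + s * x) s.
Proof. by apply: is_derive_eq; rewrite /GRing.scale/=; ring. Qed.

Lemma is_derive_sinD (a s x : R) :
  is_derive x (1 : R) (fun x : R => sin (a + s * x)) (s * cos (a + s * x)).
Proof.
have := @is_derive1_comp _ sin (fun x : R => a + s * x) x _ _ (is_derive_sin _)
  (is_derive_phase a s x).
by move=> h; apply: is_derive_eq; rewrite mulrC.
Qed.

Lemma is_derive_cosD (a s x : R) :
  is_derive x (1 : R) (fun x : R => cos (a + s * x)) (- (s * sin (a + s * x))).
Proof.
have := @is_derive1_comp _ cos (fun x : R => a + s * x) x _ _ (is_derive_cos _)
  (is_derive_phase a s x).
by move=> h; apply: is_derive_eq; rewrite mulrC mulrN.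
Qed.

(** Half of the exponent absorbs the polynomial factor.  This gives the
    majorant, uniform in the frequency, under which the Fourier integral is
    differentiated. *)
Lemma normr_gauss1_le (b x : R) : 0 < b ->
  `|x| * gauss1 b x <= (1 + 4 / b) * gauss1 (b / 2) x.
Proof.
move=> b0; have x2 := sqr_ge0 x.
have -> : gauss1 b x = gauss1 (b / 2) x * gauss1 (b / 2) x.
  by rewrite /gauss1 -expRD; congr expR; field.
rewrite mulrA ler_wpM2r ?expR_ge0//.
have /= e1 := expR_ge1Dx (b / 2 / 2 * x ^+ 2).
have e0 : 0 < expR (b / 2 / 2 * x ^+ 2) by exact: expR_gt0.
rewrite /gauss1 mulNr expRN ler_pdivrMr//.
have x1 : `|x| <= 1 + x ^+ 2.
  rewrite -[x ^+ 2]real_normK ?num_real//.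
  have := sqr_ge0 (`|x| - 1); have := normr_ge0 x; nra.
apply: (@le_trans _ _ ((1 + 4 / b) * (1 + b / 2 / 2 * x ^+ 2))); last first.
  by rewrite ler_wpM2l// addr_ge0// divr_ge0// ltW.
apply: (le_trans x1).
have -> : (1 + 4 / b) * (1 + b / 2 / 2 * x ^+ 2) =
    1 + x ^+ 2 + 4 / b + b / 4 * x ^+ 2 by field; rewrite gt_eqF.
have : 0 <= 4 / b by rewrite divr_ge0// ltW.
have : 0 <= b / 4 * x ^+ 2 by rewrite mulr_ge0// divr_ge0// ltW.
by move: (b / 4 * _) (4 / b) => u v; lra.
Qed.

Lemma continuous_gaussM (b a s : R) (f : R -> R) : continuous f ->
   continuous (fun x : R => gauss1 b x * f (a + s * x)).
Proof.
move=> cf x; apply: cvgM; first exact: continuous_gauss1.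
apply: continuous_comp; last exact: cf.
by apply: cvgD; [exact: cvg_cst|apply: cvgM; [exact: cvg_cst|exact: cvg_id]].
Qed.

Lemma continuous_xgaussM (b a s : R) (f : R -> R) : continuous f ->
   continuous (fun x : R => x * (gauss1 b x * f (a + s * x))).
Proof.
by move=> cf x; apply: cvgM; [exact: cvg_id|exact: continuous_gaussM].
Qed.

Lemma integrable_gauss1M (b a s : R) (f : R -> R) : 0 < b -> continuous f ->
  (forall x, `|f x| <= 1) ->
  mu.-integrable setT (EFin \o (fun x : R => gauss1 b x * f (a + s * x))).
Proof.
move=> b0 cf f1; apply: dominated_integrable (integrable_gauss1 b0) _.
  by apply: continuous_measurable_fun; exact: continuous_gaussM.
by move=> x; rewrite normrM (ger0_norm (gauss1_ge0 _ _)) ler_piMr ?gauss1_ge0.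
Qed.

Lemma integrable_gauss1Z (c b : R) : 0 < b ->
  mu.-integrable setT (EFin \o (fun x : R => c * gauss1 b x)).
Proof.
by move=> b0; apply: eq_integrable (integrableZl measurableT c (integrable_gauss1 b0)).
Qed.

Lemma integrable_xgauss1M (b a s : R) (f : R -> R) : 0 < b -> continuous f ->
  (forall x, `|f x| <= 1) ->
  mu.-integrable setT (EFin \o (fun x : R => x * (gauss1 b x * f (a + s * x)))).
Proof.
move=> b0 cf f1.
have b20 : 0 < b / 2 by rewrite divr_gt0.
apply: (dominated_integrable _ (integrable_gauss1Z (1 + 4 / b) b20)).
- by apply: continuous_measurable_fun; exact: continuous_xgaussM.
- move=> x; apply: le_trans (normr_gauss1_le x b0).
  by rewrite 2!normrM (ger0_norm (gauss1_ge0 _ _)) ler_wpM2l// ler_piMr ?gauss1_ge0.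
Qed.

Lemma gauss1_cos_ibp (b a s : R) : 0 < b ->
  (b * \int[mu]_x (x * (gauss1 b x * sin (a + s * x))) =
   s * \int[mu]_x (gauss1 b x * cos (a + s * x)))%R.
Proof.
move=> b0.
have i1 := integrable_xgauss1M a s b0 (@continuous_sin R) (@sin_max R).
have i2 := integrable_gauss1M a s b0 (@continuous_cos R) (@cos_max R).
apply/eqP; rewrite -subr_eq0 -oppr_eq0 opprB; apply/eqP.
rewrite -!RintegralZl//.
have j1 := integrableZl measurableT b i1.
have j2 := integrableZl measurableT s i2.
rewrite -RintegralB//.
apply: (@Rintegral_derivative0 _ (fun x => gauss1 b x * sin (a + s * x)) _ (gauss1 b)).
- move=> x; have := is_derive_gauss1 b x; have := is_derive_sinD a s x => h1 h2.
  by apply: is_derive_eq; rewrite /GRing.scale/=; ring.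
- move=> x; apply: cvgB; apply: cvgM; try exact: cvg_cst.
    by apply: continuous_gaussM; exact: continuous_cos.
  by apply: continuous_xgaussM; exact: continuous_sin.
- by apply: eq_integrable (integrableB measurableT j2 j1).
- by move=> x; rewrite normrM (ger0_norm (gauss1_ge0 _ _)) ler_piMr ?gauss1_ge0 ?sin_max.
- by move=> x; rewrite /gauss1 sqrrN.
have c2 : 2 / b * n.+1%:R^-1 @[n --> \oo] --> (0 : R).
  rewrite -[X in _ --> X](mulr0 (2 / b)); apply: cvgM; first exact: cvg_cst.
  exact: cvg_harmonic.
apply: (squeeze_cvgr _ (cvg_cst 0) c2); near=> n.
rewrite gauss1_ge0/= /gauss1 mulNr expRN -(invf_div b 2) -invfM lef_pV2 ?posrE.
- apply: (@le_trans _ _ (b / 2 * n.+1%:R ^+ 2)).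
    by rewrite ler_pM2l ?divr_gt0// expr2 ler_peMr// ler1n.
  by apply: le_trans (expR_ge1Dx _); rewrite lerDr.
- exact: expR_gt0.
- by rewrite mulr_gt0// divr_gt0.
Unshelve. all: by end_near. Qed.

(** As a function of the frequency s the integral solves E' = - (s / b) E, by
    differentiation under the integral sign and the integration by parts
    above.  The phase a takes care of sine and cosine transforms at once. *)
Lemma integral_gauss1_cos (b a s : R) : 0 < b ->
  (\int[mu]_x (gauss1 b x * cos (a + s * x)))%R =
  Num.sqrt (2 * pi / b) * gauss1 b^-1 s * cos a.
Proof.
move=> b0.
pose E s := (\int[mu]_x (gauss1 b x * cos (a + s * x)))%R.
have dE r : is_derive r (1 : R) E (- (r / b * E r)).
  pose f (s x : R) := gauss1 b x * cos (a + s * x).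
  have df (x y : R) : is_derive x (1 : R) (f ^~ y)
      (- (y * (gauss1 b y * sin (a + x * y)))).
    have h := is_derive_cosD a y x.
    rewrite /f; under eq_fun do rewrite [_ * y]mulrC.
    by apply: is_derive_eq; rewrite /GRing.scale/= [y * x]mulrC; ring.
  have b20 : 0 < b / 2 by rewrite divr_gt0.
  have Ir : `](r - 1), (r + 1)[%classic r.
    by rewrite /= in_itv/= ltrBlDr !ltrDl ltr01.
  have intf x : `](r - 1), (r + 1)[%classic x -> mu.-integrable setT (EFin \o f x).
    by move=> _; exact: (integrable_gauss1M a x b0 (@continuous_cos R) (@cos_max R)).
  have derf x y : `](r - 1), (r + 1)[%classic x -> [set: R] y -> derivable (f ^~ y) x 1.
    by move=> _ _; case: (df x y).
  have G0 (y : R) : 0 <= (1 + 4 / b) * gauss1 (b / 2) y.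
    by rewrite mulr_ge0 ?gauss1_ge0// addr_ge0// divr_ge0// ltW.
  have Gub x y : `](r - 1), (r + 1)[%classic x -> [set: R] y ->
      `|partial1of2 f x y| <= (1 + 4 / b) * gauss1 (b / 2) y.
    move=> _ _; rewrite partial1of2E; case: (df x y) => _ ->.
    rewrite normrN normrM; apply: le_trans (normr_gauss1_le y b0).
    by rewrite normrM (ger0_norm (gauss1_ge0 _ _)) ler_wpM2l// ler_piMr ?sin_max ?gauss1_ge0.
  have iG := integrable_gauss1Z (1 + 4 / b) b20.
  have H1 := derivable_under_integral measurableT Ir intf derf G0 iG Gub.
  have H2 := differentiation_under_integral measurableT Ir intf derf G0 iG Gub.
  apply: DeriveDef; first exact: H1.
  rewrite -derive1E H2.
  under eq_Rintegral do rewrite partial1of2E.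
  rewrite (_ : (fun x => _) = (fun y => (-1) * (y * (gauss1 b y * sin (a + r * y))))); last first.
    by apply/funext => y; case: (df r y) => _ ->; rewrite mulN1r.
  rewrite RintegralZl//; last first.
    exact: (integrable_xgauss1M a r b0 (@continuous_sin R) (@sin_max R)).
  have := gauss1_cos_ibp a r b0; rewrite -/(E r) => h.
  by rewrite mulN1r; congr (- _); apply: (mulfI (lt0r_neq0 b0)); rewrite h; field; rewrite gt_eqF.
pose H s := E s * gauss1 (- b^-1) s.
have dH r : is_derive r (1 : R) H 0.
  have h1 := dE r; have h2 := is_derive_gauss1 (- b^-1) r.
  by apply: is_derive_eq; rewrite /GRing.scale/=; ring.
have := is_derive_0_is_cst s 0 dH; rewrite /H.
have -> : E 0 = Num.sqrt (2 * pi / b) * cos a.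
  rewrite /E; under eq_Rintegral do rewrite mul0r addr0 mulrC.
  rewrite RintegralZl//; last exact: integrable_gauss1.
  by rewrite /Rintegral integral_gauss1//= mulrC.
have -> : gauss1 (- b^-1) 0 = 1 :> R by rewrite /gauss1 expr0n mulr0 expR0.
rewrite mulr1 => h; rewrite -/(E s) [RHS]mulrAC -h -mulrA -expRD.
rewrite (_ : _ + _ = 0) ?expR0 ?mulr1//.
by field; rewrite gt_eqF.
Qed.

End gaussian_cos.

(** * Integration over tuples, one coordinate at a time *)
Section leb_integral.
Context {R : realType}.
Local Notation mu := (@lebesgue_measure R).
Local Notation mR := (measurableTypeR R).

Lemma ge0_integral_lebS n (f : n.+1.-tuple mR -> \bar R) :
  measurable_fun setT f -> (forall t, 0 <= f t)%E ->
  (\int[leb n.+1]_t f t = \int[mu]_x \int[leb n]_t f (tcons (x, t)))%E.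
Proof.
move=> mf f0.
have h := @ge0_integral_pushforward _ _ _ _ R _ (@measurable_tcons R n)
  (mu \x leb n)%E _ f measurableT mf (fun y _ => f0 y).
apply: (etrans h); rewrite preimage_setT fubini_tonelli1//.
  by apply: measurableT_comp => //; exact: measurable_tcons.
by move=> x; exact: f0.
Qed.

Lemma integral_lebS n (f : n.+1.-tuple mR -> \bar R) :
  (leb n.+1).-integrable setT f ->
  (\int[leb n.+1]_t f t = \int[mu]_x \int[leb n]_t f (tcons (x, t)))%E.
Proof.
move=> /integrableP[mf fi].
have mft : measurable_fun setT (f \o @tcons R n).
  by apply: measurableT_comp => //; exact: measurable_tcons.
have ift : (mu \x leb n)%E.-integrable setT (f \o @tcons R n).
  apply/integrableP; split => //; apply: le_lt_trans fi.
  rewrite ge0_integral_lebS//; last exact: measurableT_comp.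
  by rewrite fubini_tonelli1//; exact: measurableT_comp.
have h := @integral_pushforward _ _ _ _ R _ (@measurable_tcons R n)
  (mu \x leb n)%E setT f mf.
rewrite preimage_setT in h.
by apply: (etrans (h ift measurableT)); rewrite -integral12_prod_meas1.
Qed.

Lemma measurable_prod_tnth n (phi : 'I_n -> R -> R) :
  (forall i, measurable_fun [set: mR] (phi i)) ->
  measurable_fun setT (fun t : n.-tuple mR => \prod_(i < n) phi i (tnth t i)).
Proof.
move=> mphi; apply: measurable_prod => i _.
apply: measurableT_comp; first exact: mphi.
exact: measurable_tnth.
Qed.

Lemma integral_leb_prod n (phi : 'I_n -> R -> R) (c : 'I_n -> R) :
  (forall i, measurable_fun [set: mR] (phi i)) ->
  (forall i x, 0 <= phi i x) ->
  (forall i, \int[mu]_x (phi i x)%:E = (c i)%:E)%E ->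
  (\int[leb n]_t (\prod_(i < n) phi i (tnth t i))%:E = (\prod_(i < n) c i)%:E)%E.
Proof.
elim: n phi c => [|n IH] phi c mphi phi0 phic.
  rewrite integral_dirac//= ?diracT ?mul1e ?big_ord0//.
  under eq_fun do rewrite big_ord0.
  exact: measurable_cst.
rewrite ge0_integral_lebS; last 2 first.
- by apply/measurable_EFinP; exact: measurable_prod_tnth.
- by move=> t; rewrite lee_fin prodr_ge0.
have c0 i : 0 <= c i.
  by rewrite -lee_fin -phic; apply: integral_ge0 => x _; rewrite lee_fin.
rewrite big_ord_recl EFinM -phic -ge0_integralZr//=; last 3 first.
- exact/measurable_EFinP.
- by move=> x _; rewrite lee_fin.
- by rewrite lee_fin prodr_ge0.
apply: eq_integral => x _.
rewrite -(IH (fun i => phi (lift ord0 i)) (fun i => c (lift ord0 i)))// -ge0_integralZl//=; last 3 first.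
- apply/measurable_EFinP.
  exact: (@measurable_prod_tnth n (fun i => phi (lift ord0 i))).
- by move=> t _; rewrite lee_fin prodr_ge0.
- by rewrite lee_fin.
apply: eq_integral => t _; rewrite big_ord_recl /= -EFinM tnth0.
by congr (_ * _)%:E; apply: eq_bigr => i _; rewrite tnthS.
Qed.

Definition sqnorm n (t : n.-tuple R) : R := \sum_(i < n) tnth t i ^+ 2.

Definition gauss_tuple n (b : R) (t : n.-tuple R) : R := expR (- (b / 2) * sqnorm t).

Lemma sqnorm_ge0 n (t : n.-tuple R) : 0 <= sqnorm t.
Proof. by apply: sumr_ge0 => i _; exact: sqr_ge0. Qed.

Lemma gauss_tuple_ge0 n b (t : n.-tuple R) : 0 <= gauss_tuple b t.
Proof. exact: expR_ge0. Qed.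

Lemma gauss_tupleE n b (t : n.-tuple R) :
  gauss_tuple b t = \prod_(i < n) gauss1 b (tnth t i).
Proof. by rewrite /gauss_tuple mulr_sumr expR_sum. Qed.

Lemma gauss_tuple_cons n b x (t : n.-tuple R) :
  gauss_tuple b [tuple of x :: t] = gauss1 b x * gauss_tuple b t.
Proof.
rewrite !gauss_tupleE big_ord_recl tnth0; congr (_ * _).
by apply: eq_bigr => i _; rewrite tnthS.
Qed.

Lemma measurable_gauss_tuple n b : measurable_fun [set: n.-tuple mR] (@gauss_tuple n b).
Proof.
rewrite (_ : @gauss_tuple n b = fun t => \prod_(i < n) gauss1 b (tnth t i)).
  by apply: (@measurable_prod_tnth n (fun=> gauss1 b)) => i; exact: measurable_gauss1.
by apply/funext => t; rewrite gauss_tupleE.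
Qed.

Lemma integral_gauss_tuple n b : 0 < b ->
  (\int[leb n]_t (gauss_tuple b t)%:E = (Num.sqrt (2 * pi / b) ^+ n)%:E)%E.
Proof.
move=> b0; under eq_integral do rewrite gauss_tupleE.
rewrite (@integral_leb_prod n (fun=> gauss1 b) (fun=> Num.sqrt (2 * pi / b))).
- by rewrite prodr_const card_ord.
- by move=> i; exact: measurable_gauss1.
- by move=> i x; exact: gauss1_ge0.
- by move=> i; exact: integral_gauss1.
Qed.

Lemma integrable_gauss_tuple n b : 0 < b ->
  (leb n).-integrable setT (EFin \o @gauss_tuple n b).
Proof.
move=> b0; apply/integrableP; split.
  by apply/measurable_EFinP; exact: measurable_gauss_tuple.
under eq_integral do rewrite /= ger0_norm ?gauss_tuple_ge0//.
by rewrite integral_gauss_tuple// ltry.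
Qed.

Definition phase n (xi : 'I_n -> R) (t : n.-tuple R) : R :=
  \sum_(i < n) xi i * tnth t i.

Lemma measurable_phase n (xi : 'I_n -> R) :
  measurable_fun [set: n.-tuple mR] (@phase n xi).
Proof.
apply: measurable_sum => i; apply: measurable_funM; first exact: measurable_cst.
exact: measurable_tnth.
Qed.

Lemma integrable_gauss_tuple_cos n b a (xi : 'I_n -> R) : 0 < b ->
  (leb n).-integrable setT
    (EFin \o (fun t : n.-tuple R => gauss_tuple b t * cos (a + phase xi t))).
Proof.
move=> b0; apply: dominated_integrable (integrable_gauss_tuple n b0) _.
  apply: measurable_funM; first exact: measurable_gauss_tuple.
  apply: measurableT_comp.
    by apply: continuous_measurable_fun; exact: continuous_cos.
  by apply: measurable_funD => //; exact: measurable_phase.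
by move=> t; rewrite normrM (ger0_norm (gauss_tuple_ge0 _ _)) ler_piMr ?gauss_tuple_ge0 ?cos_max.
Qed.

(** The free phase a makes the induction on the dimension work: the first
    coordinate only shifts the phase of the remaining integral. *)
Lemma integral_gauss_tuple_cos n b a (xi : 'I_n -> R) : 0 < b ->
  (\int[leb n]_t (gauss_tuple b t * cos (a + phase xi t))%:E =
  (Num.sqrt (2 * pi / b) ^+ n * (\prod_(i < n) gauss1 b^-1 (xi i)) * cos a)%:E)%E.
Proof.
move=> b0; elim: n a xi => [|n IH] a xi.
  rewrite integral_dirac//= ?diracT ?mul1e.
    rewrite gauss_tupleE /phase !big_ord0 addr0 expr0 !mul1r//.
  under eq_fun do rewrite gauss_tupleE /phase !big_ord0.
  exact: measurable_cst.
rewrite integral_lebS; last exact: integrable_gauss_tuple_cos.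
under eq_integral => x _.
  under eq_integral => t _.
    rewrite /tcons gauss_tuple_cons/= -mulrA EFinM.
    rewrite /phase big_ord_recl tnth0.
    under [X in (a + (_ + X))]eq_bigr do rewrite tnthS.
    rewrite addrA.
    over.
  rewrite /= integralZl//; last exact: (integrable_gauss_tuple_cos _ (fun i => xi (lift ord0 i))).
  rewrite (IH _ (fun i => xi (lift ord0 i))) -EFinM mulrCA.
  over.
have i1 := integrable_gauss1M a (xi ord0) b0 (@continuous_cos R) (@cos_max R).
have e1 : (\int[mu]_x (gauss1 b x * cos (a + xi ord0 * x))%:E =
    (Num.sqrt (2 * pi / b) * gauss1 b^-1 (xi ord0) * cos a)%:E)%E.
  rewrite -(integral_gauss1_cos a (xi ord0) b0) /Rintegral fineK//.
  exact: integrable_fin_num i1.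
rewrite /=; under eq_integral do rewrite EFinM.
rewrite integralZl// e1 -EFinM exprS big_ord_recl; congr EFin; ring.
Qed.

End leb_integral.

(** * Powers as averages of exponentials *)
Section subordination.
Context {R : realType}.
Local Notation mu := (@lebesgue_measure R).
Local Notation mR := (measurableTypeR R).

(** The kernel (1 - exp(-lam t)) t^(-1-sg) dt in the variable t = exp u: the
    singularities at 0 and at infinity become exponential decay on both sides,
    and scaling in lam becomes a translation in u. *)
Definition subord_kernel (sg lam u : R) : R :=
  (1 - expR (- (lam * expR u))) * expR (- (sg * u)).

Lemma subord_kernel_ge0 sg lam u : 0 <= lam -> 0 <= subord_kernel sg lam u.
Proof.
move=> l0; rewrite mulr_ge0 ?expR_ge0// subr_ge0 expR_le1 oppr_le0.
by rewrite mulr_ge0 ?expR_ge0.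
Qed.

Lemma continuous_subord_kernel sg lam : continuous (subord_kernel sg lam).
Proof.
move=> u; apply: cvgM.
  apply: cvgB; first exact: cvg_cst.
  apply: (@continuous_comp _ _ _ (fun u => - (lam * expR u)) expR).
    by apply: cvgN; apply: cvgM; [exact: cvg_cst|exact: continuous_expR].
  exact: continuous_expR.
apply: (@continuous_comp _ _ _ (fun u => - (sg * u)) expR).
  by apply: cvgN; apply: cvgM; [exact: cvg_cst|exact: cvg_id].
exact: continuous_expR.
Qed.

Lemma expRN_le_cauchy (sg u : R) : 0 < sg ->
  expR (- (sg * `|u|)) <= (1 + 2 / sg ^+ 2) * (1 + u ^+ 2)^-1.
Proof.
move=> sg0; have u0 := normr_ge0 u; have u2 := sqr_ge0 u.
have h : 1 + (sg * `|u|) ^+ 2 / 2 <= expR (sg * `|u|).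
  have := @expR_ge1Dxn R (sg * `|u|) 1.
  by apply; rewrite mulr_ge0// ltW.
have s2 : 0 < sg ^+ 2 by rewrite exprn_gt0.
rewrite expRN ler_pdivlMr ?ltr_wpDr// mulrC ler_pdivrMr ?expR_gt0//.
apply: le_trans (ler_wpM2l _ h); last by rewrite addr_ge0// divr_ge0// ltW.
rewrite exprMn real_normK ?num_real//.
have -> : (1 + 2 / sg ^+ 2) * (1 + sg ^+ 2 * u ^+ 2 / 2) =
   1 + u ^+ 2 + 2 / sg ^+ 2 + sg ^+ 2 * u ^+ 2 / 2 by field; rewrite gt_eqF.
have : 0 <= 2 / sg ^+ 2 by rewrite divr_ge0// ltW.
have : 0 <= sg ^+ 2 * u ^+ 2 / 2 by rewrite divr_ge0// mulr_ge0// ltW.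
by move: (2 / _) (_ / 2) => p q; lra.
Qed.

(** For u < 0 the decay rate is 1 - sg, which is at least sg since
    sg <= 1 / 2. *)
Lemma subord_kernel_le sg u : 0 < sg -> sg <= 1 / 2 ->
  subord_kernel sg 1 u <= expR (- (sg * `|u|)).
Proof.
move=> sg0 sg1; rewrite /subord_kernel mul1r.
have e0 := expR_gt0 (- (expR u)).
have [u0|u0] := lerP 0 u.
  by rewrite ger0_norm// ler_piMl ?expR_ge0//; lra.
rewrite ltr0_norm//.
have e1 : 1 - expR (- expR u) <= expR u by have := expR_ge1Dx (- expR u); lra.
apply: (le_trans (ler_wpM2r (expR_ge0 _) e1)).
by rewrite -expRD ler_expR; nra.
Qed.

Lemma integrable_subord_kernel1 sg : 0 < sg -> sg <= 1 / 2 ->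
  mu.-integrable setT (EFin \o subord_kernel sg 1).
Proof.
move=> sg0 sg1.
have i : mu.-integrable setT
    (EFin \o (fun u : R => (1 + 2 / sg ^+ 2) * (1 + u ^+ 2)^-1)).
  by apply: eq_integrable (integrableZl measurableT _ (@integrable_oneDsqrV R)).
apply: (dominated_integrable _ i).
- by apply: continuous_measurable_fun; exact: continuous_subord_kernel.
- move=> u; rewrite ger0_norm ?subord_kernel_ge0//.
  by apply: le_trans (subord_kernel_le _ _ _) (expRN_le_cauchy _ _).
Qed.

Definition subord_const (sg : R) : R := (\int[mu]_u subord_kernel sg 1 u)%R.

Lemma integral_subord_kernel1 sg : 0 < sg -> sg <= 1 / 2 ->
  (\int[mu]_u (subord_kernel sg 1 u)%:E = (subord_const sg)%:E)%E.
Proof.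
move=> sg0 sg1; rewrite /subord_const /Rintegral fineK//.
by apply: integrable_fin_num => //; exact: integrable_subord_kernel1.
Qed.

(** Replacing lam by 1 amounts to translating u by ln lam, and this multiplies
    exp(-sg u) by lam^-sg. *)
Lemma integral_subord_kernel sg lam : 0 < sg -> sg <= 1 / 2 -> 0 < lam ->
  (\int[mu]_u (subord_kernel sg lam u)%:E = (lam `^ sg * subord_const sg)%:E)%E.
Proof.
move=> sg0 sg1 l0.
rewrite EFinM -integral_subord_kernel1//.
rewrite (@integral_affine _ (ln lam) 1 (subord_kernel sg 1))//; last 2 first.
- exact: continuous_subord_kernel.
- by move=> u; exact: subord_kernel_ge0.
rewrite mul1e -ge0_integralZl//=; last 3 first.
- apply/measurable_EFinP/measurableT_comp.
    by apply: continuous_measurable_fun; exact: continuous_subord_kernel.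
  by apply: measurable_funD => //; exact: measurable_funM.
- by move=> u _; rewrite lee_fin subord_kernel_ge0.
- by rewrite lee_fin powR_ge0.
apply: eq_integral => u _; rewrite -EFinM; congr EFin.
rewrite /subord_kernel !mul1r expRD lnK ?posrE// [lam * _]mulrC mulrCA; congr (_ * _).
rewrite /powR gt_eqF// -expRD; congr expR; ring.
Qed.

Lemma le_Rintegral_itv01 (f : R -> R) (c : R) : 0 <= c ->
  mu.-integrable setT (EFin \o f) -> (forall u, 0 <= f u) ->
  (forall u, 0 <= u <= 1 -> c <= f u) -> c <= (\int[mu]_u f u)%R.
Proof.
move=> c0 fi f0 fc; have /integrableP[/measurable_EFinP mf _] := fi.
rewrite -lee_fin /Rintegral fineK; last exact: integrable_fin_num.
apply: (@le_trans _ _ (\int[mu]_(u in [set` `[0%R, 1%R]]) (f u)%:E)%E); last first.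
  apply: ge0_subset_integral => //=; first exact/measurable_EFinP.
  by move=> u _; rewrite lee_fin.
apply: (@le_trans _ _ (\int[mu]_(u in [set` `[0%R, 1%R]]) c%:E)%E).
  rewrite integral_cst//= lebesgue_measure_itv/= lte_fin ltr01 sube0 mule1//.
apply: ge0_le_integral => //=.
by apply: measurable_funTS; exact/measurable_EFinP.
Qed.

Lemma subord_const_gt0 sg : 0 < sg -> sg <= 1 / 2 -> 0 < subord_const sg.
Proof.
move=> sg0 sg1.
have c0 : 0 < (1 - expR (- 1)) * expR (- sg) :> R.
  by rewrite mulr_gt0 ?expR_gt0// subr_gt0 expR_lt1 oppr_lt0.
apply: (lt_le_trans c0); apply: le_Rintegral_itv01; first exact: ltW.
- exact: integrable_subord_kernel1.
- by move=> u; exact: subord_kernel_ge0.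
- move=> u /andP[u0 u1]; rewrite /subord_kernel mul1r ler_pM ?expR_ge0//.
  + rewrite lerD2l lerN2 ler_expR lerN2.
    by have := expR_ge1Dx u; lra.
  + by rewrite ler_expR lerN2 ler_piMr// ltW.
Qed.

End subordination.

(** * Bessel potentials of Gaussians *)
Section multiplier.
Context {R : realType}.
Local Notation mu := (@lebesgue_measure R).
Local Notation mR := (measurableTypeR R).

Definition gauss n (b : R) (x : 'rV[R]_n) : R := expR (- (b / 2) * dot x x).

(** exp(-tau) times the heat flow exp(tau Delta) applied to gauss b. *)
Definition damped_heat n (b tau : R) (x : 'rV[R]_n) : R :=
  expR (- tau) * (Num.sqrt (1 + 2 * b * tau))^-1 ^+ n *
  gauss (b / (1 + 2 * b * tau)) x.

(** The integrand of subord_const sg times J^(2 sg) applied to gauss b, at the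
    time tau = exp u. *)
Definition bessel_density n (sg b : R) (x : 'rV[R]_n) (u : R) : R :=
  (gauss b x - damped_heat b (expR u) x) * expR (- (sg * u)).

Definition bessel_gauss n (sg b : R) (x : 'rV[R]_n) : R := (\int[mu]_u bessel_density sg b x u)%R.

Lemma prod_gauss1_vec n b (x : 'rV[R]_n) :
  \prod_(i < n) gauss1 b (x 0 i) = gauss b x.
Proof.
rewrite /gauss /dot mulr_sumr expR_sum; apply: eq_bigr => i _.
by rewrite /gauss1 expr2.
Qed.

Lemma measurable_sqnorm n : measurable_fun [set: n.-tuple mR] (@sqnorm R n).
Proof.
apply: measurable_sum => i; apply: measurable_funX.
exact: measurable_tnth.
Qed.

Lemma powR_le1D (sg r : R) : 0 <= r -> 0 < sg -> sg <= 1 -> (1 + r) `^ sg <= 1 + r.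
Proof.
move=> r0 sg0 sg1; rewrite -[leRHS]powRr1 ?ler_powR ?addr_ge0//.
by rewrite lerDl.
Qed.

Lemma sqnorm_gauss_tuple_le n (b : R) (t : n.-tuple R) : 0 < b ->
  (1 + sqnorm t) * gauss_tuple b t <= (1 + 4 / b) * gauss_tuple (b / 2) t.
Proof.
move=> b0; have x2 := sqnorm_ge0 t.
have -> : gauss_tuple b t = gauss_tuple (b / 2) t * gauss_tuple (b / 2) t.
  by rewrite /gauss_tuple -expRD; congr expR; field.
rewrite mulrA ler_wpM2r ?expR_ge0//.
have /= e1 := expR_ge1Dx (b / 2 / 2 * sqnorm t).
rewrite /gauss_tuple mulNr expRN ler_pdivrMr ?expR_gt0//.
apply: (@le_trans _ _ ((1 + 4 / b) * (1 + b / 2 / 2 * sqnorm t))); last first.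
  by rewrite ler_wpM2l// addr_ge0// divr_ge0// ltW.
have -> : (1 + 4 / b) * (1 + b / 2 / 2 * sqnorm t) =
    1 + sqnorm t + 4 / b + b / 4 * sqnorm t by field; rewrite gt_eqF.
have : 0 <= 4 / b by rewrite divr_ge0// ltW.
have : 0 <= b / 4 * sqnorm t by rewrite mulr_ge0// divr_ge0// ltW.
by move: (b / 4 * _) (4 / b) => u v; lra.
Qed.

Lemma measurable_symbol n (sg : R) :
  measurable_fun [set: n.-tuple mR] (fun t => (1 + sqnorm t) `^ sg : R).
Proof.
apply: (@measurableT_comp _ _ _ _ _ _ (fun x : mR => x `^ sg)).
  exact: measurable_powR.
by apply: measurable_funD => //; exact: measurable_sqnorm.
Qed.

Lemma integrable_symbol n (sg b a : R) (xi : 'I_n -> R) : 0 < b ->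
  0 < sg -> sg <= 1 ->
  (leb n).-integrable setT (EFin \o (fun t : n.-tuple R =>
    (1 + sqnorm t) `^ sg * (gauss_tuple b t * cos (a + phase xi t)))).
Proof.
move=> b0 sg0 sg1; have b20 : 0 < b / 2 by rewrite divr_gt0.
have i : (leb n).-integrable setT
    (EFin \o (fun t : n.-tuple R => (1 + 4 / b) * gauss_tuple (b / 2) t)).
  by apply: eq_integrable (integrableZl measurableT _ (integrable_gauss_tuple n b20)).
apply: (dominated_integrable _ i).
  apply: measurable_funM; first exact: measurable_symbol.
  have /integrableP[/measurable_EFinP//] := integrable_gauss_tuple_cos a xi b0.
move=> t; apply: le_trans (sqnorm_gauss_tuple_le _ b0).
rewrite 2!normrM ger0_norm ?powR_ge0// (ger0_norm (gauss_tuple_ge0 _ _)).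
rewrite ler_pM ?powR_ge0 ?powR_le1D ?sqnorm_ge0//.
  by rewrite mulr_ge0 ?gauss_tuple_ge0.
by rewrite ler_piMr ?gauss_tuple_ge0 ?cos_max.
Qed.

(** The common integrand of the two iterated integrals that are exchanged:
    integrating u first gives the Bessel symbol, integrating the frequency first
    gives heat flows of a Gaussian. *)
Definition joint n (sg b a : R) (xi : 'I_n -> R) (z : n.-tuple mR * mR) : R :=
  subord_kernel sg (1 + sqnorm z.1) z.2 * (gauss_tuple b z.1 * cos (a + phase xi z.1)).

Lemma measurable_joint n sg b a (xi : 'I_n -> R) :
  measurable_fun setT (joint sg b a xi).
Proof.
have m1 : measurable_fun setT (fun z : n.-tuple mR * mR => sqnorm z.1).
  by apply: measurableT_comp; [exact: measurable_sqnorm|exact: measurable_fst].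
have me : measurable_fun [set: mR] (@expR R).
  by apply: continuous_measurable_fun; exact: continuous_expR.
apply: measurable_funM; first apply: measurable_funM.
- apply: measurable_funB => //; apply: measurableT_comp => //.
  apply: measurableT_comp => //; apply: measurable_funM.
    exact: measurable_funD.
  by apply: measurableT_comp.
- apply: measurableT_comp => //.
  by apply: measurableT_comp => //; apply: measurable_funM.
- apply: (@measurableT_comp _ _ _ _ _ _ (fun t => gauss_tuple b t * cos (a + phase xi t))).
    apply: measurable_funM; first exact: measurable_gauss_tuple.
    apply: measurableT_comp.
      by apply: continuous_measurable_fun; exact: continuous_cos.
    by apply: measurable_funD => //; exact: measurable_phase.
  exact: measurable_fst.
Qed.

Lemma integral_subord_kernelZ (sg lam c : R) : 0 < sg -> sg <= 1 / 2 -> 0 < lam ->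
  (\int[mu]_u (subord_kernel sg lam u * c)%:E = (subord_const sg * (lam `^ sg * c))%:E)%E.
Proof.
move=> sg0 sg1 l0; under eq_integral do rewrite EFinM.
rewrite integralZr//; last first.
  apply/integrableP; split.
    apply/measurable_EFinP.
    by apply: continuous_measurable_fun; exact: continuous_subord_kernel.
  under eq_integral do rewrite /= ger0_norm ?subord_kernel_ge0 ?(ltW l0)//.
  by rewrite integral_subord_kernel// ltry.
by rewrite integral_subord_kernel// -EFinM mulrA [_ * subord_const _]mulrC.
Qed.

Lemma integrable_joint n sg b a (xi : 'I_n -> R) : 0 < b ->
  0 < sg -> sg <= 1 / 2 ->
  (leb n \x mu)%E.-integrable setT (EFin \o joint sg b a xi).
Proof.
move=> b0 sg0 sg1.
have sg1' : sg <= 1 by lra.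
apply/integrable12ltyP; first by apply/measurable_EFinP; exact: measurable_joint.
have i0 := integrable_symbol a xi b0 sg0 sg1'.
have /integrableP[_ i0'] := integrableZl measurableT (subord_const sg) i0.
apply: le_lt_trans i0'; rewrite le_eqVlt; apply/orP; left; apply/eqP.
apply: eq_integral => t _.
have l0 : 0 < 1 + sqnorm t by rewrite ltr_wpDr// sqnorm_ge0.
rewrite -EFinM /= normrM (ger0_norm (ltW (subord_const_gt0 sg0 sg1))).
rewrite normrM (ger0_norm (powR_ge0 _ _)) -integral_subord_kernelZ//.
apply: eq_integral => u _.
by rewrite /joint/= normrM ger0_norm ?subord_kernel_ge0// ltW.
Qed.

(** The exponential in the kernel is exp(-tau) exp(-tau |xi|^2) with tau = exp u;
    it changes the width 1 / b of the Gaussian in frequency to 1 / b + 2 tau,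
    so both parts are Gaussian Fourier integrals. *)
Lemma integral_joint_t n sg b a (x : 'rV[R]_n) u : 0 < b ->
  (\int[leb n]_t (joint sg b^-1 a (fun i => x 0 i) (t, u))%:E =
   (Num.sqrt (2 * pi * b) ^+ n * cos a * bessel_density sg b x u)%:E)%E.
Proof.
move=> b0; set tau := expR u; have t0 : 0 < tau by exact: expR_gt0.
pose xi i := x 0 i.
have bi0 : 0 < b^-1 by rewrite invr_gt0.
pose b2 := b^-1 + 2 * tau.
have b20 : 0 < b2 by rewrite addr_gt0// mulr_gt0.
have d0 : 0 < 1 + 2 * b * tau by rewrite addr_gt0// !mulr_gt0.
pose c1 := expR (- (sg * u)); pose c2 := c1 * expR (- tau).
have jE t : joint sg b^-1 a xi (t, u) =
    c1 * (gauss_tuple b^-1 t * cos (a + phase xi t)) -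
    c2 * (gauss_tuple b2 t * cos (a + phase xi t)).
  rewrite /joint/= /subord_kernel.
  have -> : expR (- ((1 + sqnorm t) * expR u)) = expR (- tau) * expR (- (tau * sqnorm t)).
    by rewrite -expRD; congr expR; rewrite -/tau; ring.
  have -> : gauss_tuple b2 t = gauss_tuple b^-1 t * expR (- (tau * sqnorm t)).
    by rewrite /gauss_tuple -expRD; congr expR; rewrite /b2; field; rewrite gt_eqF.
  by rewrite -/c1 /c2; ring.
under eq_integral do rewrite jE EFinB.
have i1 := integrableZl measurableT c1 (integrable_gauss_tuple_cos a xi bi0).
have i2 := integrableZl measurableT c2 (integrable_gauss_tuple_cos a xi b20).
rewrite integralB//.
under eq_integral do rewrite EFinM.
under [X in (_ - X)%E]eq_integral do rewrite EFinM.
rewrite !integralZl//; try exact: integrable_gauss_tuple_cos.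
rewrite !integral_gauss_tuple_cos// !prod_gauss1_vec -!EFinM -EFinB; congr EFin.
have -> : 2 * pi / b^-1 = 2 * pi * b by rewrite invrK.
have -> : 2 * pi / b2 = 2 * pi * b * (1 + 2 * b * tau)^-1.
  rewrite /b2; field.
  by rewrite !gt_eqF// ?andbT -?/b2.
rewrite (@sqrtrM _ (2 * pi * b)) ?mulr_ge0 ?pi_ge0 ?(ltW b0)//.
rewrite sqrtrV ?ltW// exprMn invrK.
rewrite /bessel_density /damped_heat -/tau -/c1 /c2.
have -> : b2^-1 = b / (1 + 2 * b * tau).
  by rewrite /b2; field; rewrite !gt_eqF.
ring.
Qed.

Lemma integrable_fubini_G d1 d2 (T1 : measurableType d1) (T2 : measurableType d2)
  (m1 : {sigma_finite_measure set T1 -> \bar R})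
  (m2 : {sigma_finite_measure set T2 -> \bar R}) (f : T1 * T2 -> \bar R) :
  (m1 \x m2)%E.-integrable setT f ->
  m2.-integrable setT (fun y => \int[m1]_x f (x, y))%E.
Proof.
move=> fi; have /integrableP[mf _] := fi.
have mG := measurable_fubini_G fi.
have maf : measurable_fun setT (abse \o f) by exact: measurableT_comp.
apply/integrableP; split => //.
have h := (integrable21ltyP m1 m2 mf).1 fi; apply: le_lt_trans h.
apply: ge0_le_integral => //.
- by apply: measurableT_comp.
- by apply: (measurable_fun_fubini_tonelli_G (abse \o f)) => //=.
- move=> y _; apply: le_abse_integral => //.
  by apply: measurableT_comp.
Qed.

Lemma integrable_bessel_density n sg b (x : 'rV[R]_n) : 0 < b -> 0 < sg -> sg <= 1 / 2 ->
  mu.-integrable setT (EFin \o bessel_density sg b x).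
Proof.
move=> b0 sg0 sg1; have bi0 : 0 < b^-1 by rewrite invr_gt0.
have := integrable_fubini_G (integrable_joint 0 (fun i => x 0 i) bi0 sg0 sg1).
rewrite (_ : (fun u => _) = fun u =>
    ((Num.sqrt (2 * pi * b) ^+ n)%:E * (bessel_density sg b x u)%:E)%E); last first.
  by apply/funext => u; rewrite /= integral_joint_t// cos0 mulr1 EFinM.
set c := Num.sqrt _ ^+ n => i.
have c0 : c != 0.
  by rewrite expf_neq0// gt_eqF// sqrtr_gt0 !mulr_gt0// pi_gt0.
apply: eq_integrable (integrableZl measurableT c^-1 i) => // u _.
by rewrite /= -!EFinM mulrA mulVf// mul1r.
Qed.

(** Fubini for the function joint: the Fourier integral of the Bessel symbol
    against a Gaussian equals, up to a constant, the average of heat flows. *)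
Lemma symbol_formula n sg b a (x : 'rV[R]_n) : 0 < b -> 0 < sg -> sg <= 1 / 2 ->
  (\int[leb n]_t ((1 + sqnorm t) `^ sg *
      (gauss_tuple b^-1 t * cos (a + phase (fun i => x 0 i) t)))%:E =
   (Num.sqrt (2 * pi * b) ^+ n / subord_const sg * bessel_gauss sg b x * cos a)%:E)%E.
Proof.
move=> b0 sg0 sg1; have bi0 : 0 < b^-1 by rewrite invr_gt0.
have K0 := subord_const_gt0 sg0 sg1.
have sg1' : sg <= 1 by lra.
pose xi i := x 0 i.
have iJ := integrable_bessel_density x b0 sg0 sg1.
have bgE : (\int[mu]_u (bessel_density sg b x u)%:E = (bessel_gauss sg b x)%:E)%E.
  by rewrite /bessel_gauss /Rintegral fineK//; exact: integrable_fin_num iJ.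
have h := Fubini (integrable_joint a xi bi0 sg0 sg1).
have h1 : (\int[leb n]_t \int[mu]_u (EFin \o joint sg b^-1 a xi) (t, u) =
    (subord_const sg)%:E * \int[leb n]_t ((1 + sqnorm t) `^ sg *
      (gauss_tuple b^-1 t * cos (a + phase xi t)))%:E)%E.
  rewrite -integralZl//; last exact: integrable_symbol.
  apply: eq_integral => t _; rewrite -EFinM -integral_subord_kernelZ//.
  by rewrite ltr_wpDr// sqnorm_ge0.
have h2 : (\int[mu]_u \int[leb n]_t (EFin \o joint sg b^-1 a xi) (t, u) =
    (Num.sqrt (2 * pi * b) ^+ n * cos a * bessel_gauss sg b x)%:E)%E.
  rewrite EFinM -bgE -integralZl//.
  by apply: eq_integral => u _; rewrite /= integral_joint_t// EFinM.
move: h; rewrite h1 h2 => h.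
have -> : (Num.sqrt (2 * pi * b) ^+ n / subord_const sg * bessel_gauss sg b x * cos a)%:E =
   ((subord_const sg)^-1%:E * (Num.sqrt (2 * pi * b) ^+ n * cos a * bessel_gauss sg b x)%:E)%E.
  by rewrite -EFinM; congr EFin; ring.
by rewrite -h muleA -EFinM mulVf ?mul1e// gt_eqF.
Qed.

End multiplier.

Section bessel_sum.
Context {R : realType}.
Local Notation mu := (@lebesgue_measure R).
Local Notation mR := (measurableTypeR R).

Lemma integral_sum_EFin d (T : measurableType d) (m : {measure set T -> \bar R})
    (D : set T) N (f : 'I_N -> T -> R) (v : 'I_N -> R) : measurable D ->
  (forall k, m.-integrable D (EFin \o f k)) ->
  (forall k, \int[m]_(t in D) (f k t)%:E = (v k)%:E)%E ->
  (\int[m]_(t in D) (\sum_(k < N) f k t)%:E = (\sum_(k < N) v k)%:E)%E.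
Proof.
move=> mD fi fv; under eq_integral do rewrite -sumEFin.
rewrite (@integral_sum _ _ _ _ D mD _ (fun k => EFin \o f k))//.
by rewrite -sumEFin; apply: eq_bigr => k _; exact: fv.
Qed.

Lemma dot_vec n (t : n.-tuple mR) (x : 'rV[R]_n) :
  dot (vec t) x = phase (fun i => x 0 i) t.
Proof. by apply: eq_bigr => i _; rewrite mxE mulrC. Qed.

Lemma dot_vec2 n (t : n.-tuple mR) : dot (vec t) (vec t) = sqnorm t.
Proof. by apply: eq_bigr => i _; rewrite mxE expr2. Qed.

Lemma gauss_vec n b (t : n.-tuple mR) : gauss b (vec t) = gauss_tuple b t.
Proof. by rewrite /gauss dot_vec2. Qed.

Lemma phaseN n (xi : 'I_n -> R) t : phase (fun i => - xi i) t = - phase xi t.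
Proof. by rewrite /phase -sumrN; apply: eq_bigr => i _; rewrite mulNr. Qed.

(** The phase a gives the real part for a = 0 and the imaginary part for
    a = - pi / 2, since sin y = cos (y - pi / 2). *)
Lemma cintegral_cis n (h : n.-tuple mR -> R) (F : 'rV[R]_n -> R[i])
    (xi : 'I_n -> R) (c : R) :
  (forall t, F (vec t) = (h t)%:C * cis (phase xi t)) ->
  (forall a, \int[leb n]_t (h t * cos (a + phase xi t))%:E = (c * cos a)%:E)%E ->
  cintegral setT F = c%:C.
Proof.
move=> Fh hc; rewrite /cintegral preimage_setT.
have -> : (\int[leb n]_t complex.Re (F (vec t)))%R = c.
  rewrite /Rintegral (_ : (fun t => _) =
     (fun t : n.-tuple mR => (h t * cos (0 + phase xi t))%:E)).
    by rewrite hc cos0 mulr1.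
  by apply/funext => t; rewrite Fh /= mul0r subr0 add0r.
have -> : (\int[leb n]_t complex.Im (F (vec t)))%R = 0.
  rewrite /Rintegral (_ : (fun t => _) =
     (fun t : n.-tuple mR => (h t * cos (- (pi / 2) + phase xi t))%:E)).
    by rewrite hc cosN cos_pihalf mulr0.
  by apply/funext => t; rewrite Fh /= mul0r addr0 [- _ + _]addrC cosBpihalf.
by [].
Qed.

Definition gauss_sum n N (c b : nat -> R) (x : 'rV[R]_n) : R :=
  \sum_(k < N) c k * gauss (b k) x.

Lemma fourier_gauss_sum n N (c b : nat -> R) (xi : 'rV[R]_n) :
  (forall k, 0 < b k) ->
  fourier (fun x : 'rV[R]_n => (gauss_sum N c b x)%:C) xi =
  (gauss_sum N (fun k => c k * Num.sqrt (2 * pi / b k) ^+ n) (fun k => (b k)^-1) xi)%:C.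
Proof.
move=> b0; rewrite /fourier.
apply: (@cintegral_cis _ (fun t => gauss_sum N c b (vec t)) _ (fun i => - xi 0 i)).
  by move=> t; rewrite phaseN dot_vec.
move=> a; rewrite /gauss_sum mulr_suml.
under eq_integral do rewrite mulr_suml.
apply: integral_sum_EFin => // k.
  have := integrableZl measurableT (c k) (integrable_gauss_tuple_cos a (fun i => - xi 0 i) (b0 k)).
  by apply: eq_integrable => // t _; rewrite /= gauss_vec -EFinM mulrA.
under eq_integral do rewrite gauss_vec -mulrA EFinM.
rewrite integralZl//; last exact: integrable_gauss_tuple_cos.
rewrite integral_gauss_tuple_cos// -EFinM.
under eq_bigr do rewrite /gauss1 sqrrN.
by rewrite (prod_gauss1_vec (b k)^-1 xi) !mulrA.
Qed.

Lemma bessel_gauss_sum n N (c b : nat -> R) s (x : 'rV[R]_n) :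
  (forall k, 0 < b k) -> 0 < s -> s <= 1 ->
  bessel s (fun x : 'rV[R]_n => (gauss_sum N c b x)%:C) x =
  ((subord_const (s / 2))^-1 * \sum_(k < N) c k * bessel_gauss (s / 2) (b k) x)%:C.
Proof.
move=> b0 s0 s1; have sg0 : 0 < s / 2 by rewrite divr_gt0.
have sg1 : s / 2 <= 1 / 2 by lra.
have sg1' : s / 2 <= 1 by lra.
rewrite /bessel /fourier_multiplier /inv_fourier.
pose g (xi : 'rV[R]_n) := gauss_sum N (fun k => c k * Num.sqrt (2 * pi / b k) ^+ n) (fun k => (b k)^-1) xi.
pose v k := c k * Num.sqrt (2 * pi / b k) ^+ n *
   (Num.sqrt (2 * pi * b k) ^+ n / subord_const (s / 2) * bessel_gauss (s / 2) (b k) x).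
rewrite (@cintegral_cis _ (fun t => (1 + sqnorm t) `^ (s / 2) * g (vec t)) _ 
   (fun i => x 0 i) (\sum_(k < N) v k)).
- rewrite -rmorphM; congr (_%:C); rewrite !mulr_sumr; apply: eq_bigr => k _.
  rewrite /v.
  have b2 := b0 k.
  have p0 := @pi_gt0 R.
  have -> : (2 * pi) ^- n = (Num.sqrt (2 * pi / b k) ^+ n * Num.sqrt (2 * pi * b k) ^+ n)^-1.
    rewrite -exprMn -sqrtrM ?divr_ge0 ?mulr_ge0 ?ltW//.
    rewrite (_ : 2 * pi / b k * _ = (2 * pi) ^+ 2); last by field; rewrite gt_eqF.
    by rewrite sqrtr_sqr ger0_norm// mulr_ge0 ?ltW.
  have e1 : Num.sqrt (2 * pi / b k) ^+ n != 0.
    by rewrite expf_neq0// gt_eqF// sqrtr_gt0 divr_gt0// mulr_gt0.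
  have e2 : Num.sqrt (2 * pi * b k) ^+ n != 0.
    by rewrite expf_neq0// gt_eqF// sqrtr_gt0 !mulr_gt0.
  have e3 : subord_const (s / 2) != 0 by rewrite gt_eqF// subord_const_gt0.
  by field; rewrite e1 e2 e3.
- move=> t; rewrite fourier_gauss_sum// -rmorphM dot_vec2; congr (_ * cis _).
  by rewrite -dot_vec /dot; apply: eq_bigr => i _; rewrite mulrC.
- move=> a; rewrite mulr_suml.
  rewrite (_ : (fun t => _) = (fun t : n.-tuple mR => (\sum_(k < N)
      (c k * Num.sqrt (2 * pi / b k) ^+ n) * ((1 + sqnorm t) `^ (s / 2) *
       (gauss_tuple (b k)^-1 t * cos (a + phase (fun i => x 0 i) t))))%:E)); last first.
    apply/funext => t; rewrite /g /gauss_sum mulr_sumr mulr_suml; congr EFin.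
    by apply: eq_bigr => k _; rewrite gauss_vec; ring.
  apply: integral_sum_EFin => // k; have bi0 : 0 < (b k)^-1 by rewrite invr_gt0.
    have := integrableZl measurableT (c k * Num.sqrt (2 * pi / b k) ^+ n)
      (integrable_symbol a (fun i => x 0 i) bi0 sg0 sg1').
    by apply: eq_integrable.
  under eq_integral do rewrite EFinM.
  rewrite integralZl//; last exact: integrable_symbol.
  by rewrite symbol_formula// -EFinM /v !mulrA.
Qed.

End bessel_sum.

(** * Lower bound for the commutator with a Gaussian *)
Section pointwise_bounds.
Context {R : realType}.
Local Notation mu := (@lebesgue_measure R).

Lemma dot_ge0 n (x : 'rV[R]_n) : 0 <= dot x x.
Proof. by apply: sumr_ge0 => i _; rewrite -expr2 sqr_ge0. Qed.

Lemma sqrt_expR (y : R) : Num.sqrt (expR (2 * y)) = expR y.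
Proof.
by rewrite [2 * y]mulrC expRM_natr sqrtr_sqr ger0_norm ?expR_ge0.
Qed.

(** Since A / B = 1 - 2 tau / B <= exp (- 2 tau / B); taking square roots keeps
    the estimate free of logarithms. *)
Lemma sqrtV_gap (A B tau : R) : 0 < A -> B = A + 2 * tau -> 0 < tau ->
  expR (tau / B) * (Num.sqrt B)^-1 <= (Num.sqrt A)^-1.
Proof.
move=> A0 BE t0; have B0 : 0 < B by rewrite BE addr_gt0// mulr_gt0.
have h : A / B <= expR (- (2 * (tau / B))).
  apply: le_trans (expR_ge1Dx _).
  by rewrite BE le_eqVlt; apply/orP; left; apply/eqP; field; rewrite -BE gt_eqF.
have {}h : A * expR (2 * (tau / B)) <= B.
  move: h; rewrite expRN ler_pdivrMr// mulrC => h.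
  by rewrite -ler_pdivlMr ?expR_gt0.
have := ler_wsqrtr h; rewrite sqrtrM; last exact: ltW.
rewrite sqrt_expR => {}h.
by rewrite ler_pdivrMr ?sqrtr_gt0// ler_pdivlMl ?sqrtr_gt0.
Qed.

(** The exponents differ by r / 2 times 1 - 1 / (A B), which is at most
    (2 tau / B) (1 + 2 eps). *)
Lemma exp_gap (A B eps tau r : R) : 0 < eps -> 0 < tau -> 0 <= r ->
  A = 1 + 2 * eps * tau -> B = 1 + 2 * (1 + eps) * tau ->
  expR (- (tau / B * ((1 + 2 * eps) * r))) * expR (- ((1 + eps) / B / 2) * r) <=
  expR (- (1 / 2) * r) * expR (- (eps / A / 2) * r).
Proof.
move=> e0 t0 r0 AE BE.
have et : 0 < eps * tau by rewrite mulr_gt0.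
have A1 : 1 <= A by rewrite AE -mulrA lerDl mulr_ge0// ltW.
have A0 : 0 < A by lra.
have B0 : 0 < B by rewrite BE -mulrA addr_gt0// mulr_gt0// mulr_gt0//; lra.
rewrite -!expRD ler_expR -subr_ge0.
rewrite (_ : _ - _ = r / (2 * A * B) * (2 * tau * (A * (1 + 2 * eps)) + A * (1 + eps) - A * B - eps * B)); last first.
  by field; rewrite !gt_eqF.
apply: mulr_ge0; first by rewrite divr_ge0// ltW// !mulr_gt0.
by rewrite AE BE; nra.
Qed.

(** The product of lower bounds, for 0 <= u <= 1 and tau = exp u, of the weight
    exp(-sg u), of exp(-tau), of the normalisation and of the exponential of the
    heat flow, and of the gain tau / B times n / 4. *)
Definition gap_const n : R :=
  expR (- 1) * (expR (- expR 1) * ((Num.sqrt (1 + 4 * expR 1))^-1 ^+ n *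
    (expR (- n%:R) * ((1 + 4 * expR 1)^-1 / 4)))).

Lemma gap_const_gt0 n : 0 < gap_const n.
Proof.
have e : 0 < 1 + 4 * expR 1 :> R by rewrite addr_gt0// mulr_gt0// expR_gt0.
by rewrite !mulr_gt0 ?expR_gt0 ?exprn_gt0 ?invr_gt0 ?sqrtr_gt0.
Qed.

(** With r = |x|^2 the quotient of the right-hand side by
    damped_heat (1 + eps) tau x is at least exp ((tau / B) (n - (1 + 2 eps) r)),
    by sqrtV_gap and exp_gap, and (1 + 2 eps) r <= 3 n / 4. *)
Lemma heat_gap n (eps tau : R) (x : 'rV[R]_n) : 0 < eps -> eps <= 1 -> 0 < tau ->
  dot x x <= n%:R / 4 ->
  damped_heat (1 + eps) tau x * (1 + tau / (1 + 2 * (1 + eps) * tau) * (n%:R / 4)) <=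
  gauss 1 x * damped_heat eps tau x.
Proof.
move=> e0 e1 t0 xn; set A := 1 + 2 * eps * tau; set B := 1 + 2 * (1 + eps) * tau.
set r := dot x x; have r0 : 0 <= r := dot_ge0 x.
have A0 : 0 < A by rewrite addr_gt0// !mulr_gt0.
have B0 : 0 < B by rewrite addr_gt0// !mulr_gt0// addr_gt0.
have BA : B = A + 2 * tau by rewrite /A /B; ring.
have h1 := sqrtV_gap A0 BA t0.
have h2 : expR (tau / B * n%:R) * (Num.sqrt B)^-1 ^+ n <= (Num.sqrt A)^-1 ^+ n.
  rewrite expRM_natr -exprMn; apply: lerXn2r h1; rewrite nnegrE.
    by rewrite mulr_ge0 ?expR_ge0// invr_ge0 sqrtr_ge0.
  by rewrite invr_ge0 sqrtr_ge0.
have h3 := exp_gap e0 t0 r0 (erefl A) (erefl B).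
have h4 : 1 + tau / B * (n%:R / 4) <=
    expR (tau / B * n%:R) * expR (- (tau / B * ((1 + 2 * eps) * r))).
  rewrite -expRD; apply: le_trans (expR_ge1Dx _).
  rewrite lerD2l -mulrBr; apply: ler_wpM2l.
    by rewrite divr_ge0 // ltW.
  have : (1 + 2 * eps) * r <= 3 * r by rewrite ler_wpM2r//; lra.
  by rewrite -/r in xn; lra.
rewrite /damped_heat -/A -/B /gauss -/r.
have p1 : 0 <= expR (- tau) by exact: expR_ge0.
apply: (@le_trans _ _ (expR (- tau) * ((expR (tau / B * n%:R) * (Num.sqrt B)^-1 ^+ n) *
   (expR (- (tau / B * ((1 + 2 * eps) * r))) * expR (- ((1 + eps) / B / 2) * r))))).
  rewrite -(mulrA (expR (- tau))) -(mulrA (expR (- tau))); apply: ler_wpM2l => //.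
  rewrite -[leLHS]mulrA.
  rewrite [leRHS](_ : _ = (Num.sqrt B)^-1 ^+ n * (expR (- ((1 + eps) / B / 2) * r) *
    (expR (tau / B * n%:R) * expR (- (tau / B * ((1 + 2 * eps) * r)))))); last by rewrite !mulrA; ring.
  apply: ler_wpM2l; first by rewrite exprn_ge0// invr_ge0 sqrtr_ge0.
  by apply: ler_wpM2l => //; exact: expR_ge0.
rewrite [leRHS](_ : _ = expR (- tau) * ((Num.sqrt A)^-1 ^+ n *
  (expR (- (1 / 2) * r) * expR (- (eps / A / 2) * r)))); last by ring.
by apply: ler_wpM2l => //; apply: ler_pM.
Qed.

(** In the difference the products of Gaussians cancel, and only the heat flows
    compared in heat_gap remain; they contribute a nonnegative integrand, which
    is bounded from below for u in [0, 1]. *)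
Lemma bessel_gauss_gap n (sg eps : R) (x : 'rV[R]_n) : (0 < n)%N ->
  0 < sg -> sg <= 1 / 2 -> 0 < eps -> eps <= 1 -> dot x x <= n%:R / 4 ->
  gap_const n <= bessel_gauss sg (1 + eps) x - gauss 1 x * bessel_gauss sg eps x.
Proof.
move=> n0 sg0 sg1 e0 e1 xn.
have e2 : 0 < 1 + eps by rewrite addr_gt0.
have i1 := integrable_bessel_density x e2 sg0 sg1.
have i2 := integrable_bessel_density x e0 sg0 sg1.
have i3 := integrableZl measurableT (gauss 1 x) i2.
have i4 : mu.-integrable setT
    (EFin \o (fun u => bessel_density sg (1 + eps) x u - gauss 1 x * bessel_density sg eps x u)).
  by apply: eq_integrable (integrableB measurableT i1 i3).
rewrite /bessel_gauss -RintegralZl// -RintegralB//.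
have p1 : gauss (1 + eps) x = gauss 1 x * gauss eps x.
  by rewrite /gauss -expRD; congr expR; ring.
have key u : bessel_density sg (1 + eps) x u - gauss 1 x * bessel_density sg eps x u =
  (gauss 1 x * damped_heat eps (expR u) x - damped_heat (1 + eps) (expR u) x) * expR (- (sg * u)).
  by rewrite /bessel_density p1; ring.
have gap u : damped_heat (1 + eps) (expR u) x *
      (expR u / (1 + 2 * (1 + eps) * expR u) * (n%:R / 4)) <=
    gauss 1 x * damped_heat eps (expR u) x - damped_heat (1 + eps) (expR u) x.
  have := heat_gap e0 e1 (expR_gt0 u) xn.
  by rewrite mulrDr mulr1 lerBrDl.
have h0 u : 0 <= damped_heat (1 + eps) (expR u) x.
  by rewrite !mulr_ge0 ?expR_ge0// exprn_ge0// invr_ge0 sqrtr_ge0.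
have B0 u : 0 < 1 + 2 * (1 + eps) * expR u :> R.
  by rewrite addr_gt0// mulr_gt0 ?expR_gt0// mulr_gt0.
have w0 u : 0 <= expR u / (1 + 2 * (1 + eps) * expR u) * (n%:R / 4).
  apply: mulr_ge0; last exact: divr_ge0.
  by apply: divr_ge0; [exact: expR_ge0|exact: ltW].
apply: le_Rintegral_itv01 => //.
- by rewrite ltW// gap_const_gt0.
- move=> u; rewrite key mulr_ge0 ?expR_ge0//; apply: le_trans (gap u).
  exact: mulr_ge0.
move=> u /andP[u0 u1].
have t1 : 1 <= expR u by rewrite -expR0 ler_expR.
have tE : expR u <= expR 1 by rewrite ler_expR.
have BE : 1 + 2 * (1 + eps) * expR u <= 1 + 4 * expR 1.
  by have := expR_gt0 u; nra.
have E0 : 0 < 1 + 4 * expR 1 :> R by rewrite addr_gt0// mulr_gt0// expR_gt0.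
have q0 : 0 <= (1 + 4 * expR 1)^-1 / 4 :> R by rewrite divr_ge0// invr_ge0 ltW.
have q1 : 0 <= expR (- n%:R) * ((1 + 4 * expR 1)^-1 / 4) :> R.
  by apply: mulr_ge0 => //; exact: expR_ge0.
have q2 : 0 <= (Num.sqrt (1 + 4 * expR 1))^-1 ^+ n :> R.
  by rewrite exprn_ge0// invr_ge0 sqrtr_ge0.
rewrite key mulrC; apply: ler_pM; first by rewrite expR_ge0.
- by rewrite mulr_ge0 ?expR_ge0// mulr_ge0.
- rewrite ler_expR lerN2; nra.
apply: le_trans (gap u); rewrite /damped_heat -!(mulrA (expR (- expR u))) -(mulrA (_ ^+ n)).
apply: ler_pM; [exact: expR_ge0|exact: mulr_ge0|by rewrite ler_expR lerN2|].
apply: ler_pM => //.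
  apply: lerXn2r; rewrite ?nnegrE ?invr_ge0 ?sqrtr_ge0//.
  by have := ler_wsqrtr BE; rewrite lef_pV2 ?posrE ?sqrtr_gt0.
have r0 := dot_ge0 x.
apply: ler_pM; rewrite ?expR_ge0//.
- rewrite /gauss ler_expR mulNr lerN2.
  have : (1 + eps) / (1 + 2 * (1 + eps) * expR u) <= 2.
    rewrite ler_pdivrMr//; nra.
  move: (_ / _) => c c2; have n1 : 0 <= n%:R :> R by [].
  nra.
- apply: ler_pM; rewrite ?invr_ge0 ?(ltW E0)//.
    rewrite -[leLHS]mul1r; apply: ler_pM; rewrite ?invr_ge0 ?(ltW E0)//.
    by rewrite lef_pV2 ?posrE.
  by rewrite -[leLHS]mul1r ler_wpM2r ?invr_ge0// ler1n.
Qed.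

End pointwise_bounds.

(** * Decay of the Bessel potential of a Gaussian *)
Section upper_bound.
Context {R : realType}.
Local Notation mu := (@lebesgue_measure R).

(** A product majorant: its integral over tuples factors, and its p-th power is
    integrable for every p > 1. *)
Definition cauchy_weight n (x : 'rV[R]_n) : R := \prod_(i < n) (1 + x 0 i ^+ 2)^-1.

Lemma cauchy_weight_ge0 n (x : 'rV[R]_n) : 0 <= cauchy_weight x.
Proof.
by apply: prodr_ge0 => i _; rewrite invr_ge0 addr_ge0// sqr_ge0.
Qed.

Lemma expR_dot_le n (c : R) (x : 'rV[R]_n) : 1 <= c ->
  expR (- (dot x x / c)) <= c ^+ n * cauchy_weight x.
Proof.
move=> c1; have c0 : 0 < c by lra.
have -> : c ^+ n * cauchy_weight x = \prod_(i < n) (c * (1 + x 0 i ^+ 2)^-1).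
  by rewrite big_split/= prodr_const card_ord.
rewrite /dot -mulNr -sumrN mulr_suml expR_sum.
apply: ler_prod => i _; rewrite expR_ge0/= -expr2 mulNr.
have x2 := sqr_ge0 (x 0 i).
rewrite ler_pdivlMr ?ltr_wpDr// expRN ler_pdivrMl ?expR_gt0//.
have h := expR_ge1Dx (x 0 i ^+ 2 / c).
apply: le_trans (ler_wpM2r (ltW c0) h).
by rewrite mulrDl divfK ?gt_eqF// mul1r lerD2r.
Qed.

Lemma expRN_ge0_le1 (t : R) : 0 <= t -> expR (- t) <= 1.
Proof. by move=> t0; rewrite expR_le1 oppr_le0. Qed.

Lemma sqrtV_ge_expR (t : R) : 0 < t ->
  expR (- t) <= (Num.sqrt (1 + 2 * t))^-1.
Proof.
move=> t0; have p : 0 < 1 + 2 * t by rewrite addr_gt0// mulr_gt0.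
have := ler_wsqrtr (expR_ge1Dx (2 * t)); rewrite sqrt_expR => h.
by rewrite expRN lef_pV2 ?posrE ?expR_gt0 ?sqrtr_gt0.
Qed.

Lemma sqrtV_le1 (t : R) : 0 < t -> (Num.sqrt (1 + 2 * t))^-1 <= 1.
Proof.
move=> t0; have h : 1 <= 1 + 2 * t by rewrite lerDl mulr_ge0// ltW.
have := ler_wsqrtr h; rewrite sqrtr1 => {}h.
by rewrite invf_le1// (lt_le_trans _ h).
Qed.

Lemma bernoulli_sub (y : R) m : 0 <= y -> y <= 1 -> 1 - y ^+ m <= m%:R * (1 - y).
Proof.
move=> y0 y1; elim: m => [|m IH]; first by rewrite expr0 subrr mul0r.
rewrite exprS -natr1 mulrDl mul1r.
have -> : 1 - y * y ^+ m = y * (1 - y ^+ m) + (1 - y) by ring.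
rewrite lerD2r; apply: (le_trans _ IH).
by rewrite ler_piMl// subr_ge0 exprn_ile1.
Qed.

(** Both exp(-tau) and each of the n factors (1 + 2 tau)^(-1/2) are at least
    exp(-tau), and the widened Gaussian dominates the original one, so the
    difference is at most 1 - exp(-tau)^(n+1) times the Gaussian. *)
Lemma gauss_sub_heat n (tau : R) (x : 'rV[R]_n) : 0 < tau ->
  gauss 1 x - damped_heat 1 tau x <=
  n.+1%:R * 2 ^+ n * (1 - expR (- tau)) * cauchy_weight x.
Proof.
move=> t0; have r0 := dot_ge0 x.
have G2 : gauss 1 x <= 2 ^+ n * cauchy_weight x.
  apply: le_trans (expR_dot_le x _); last by lra.
  by rewrite /gauss ler_expR; lra.
have w0 := cauchy_weight_ge0 x.
have eta1 := expRN_ge0_le1 (ltW t0).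
have h1 : expR (- tau) ^+ n.+1 * gauss 1 x <= damped_heat 1 tau x.
  rewrite exprS /damped_heat mulr1; apply: ler_pM; rewrite ?expR_ge0//.
  - apply: ler_wpM2l; first exact: expR_ge0.
    apply: lerXn2r (sqrtV_ge_expR t0); rewrite nnegrE ?expR_ge0//.
  - rewrite /gauss ler_expR !mulNr lerN2; do 2 apply: ler_wpM2r => //.
    have p : 1 <= 1 + 2 * tau by rewrite lerDl mulr_ge0// ltW.
    by rewrite div1r invf_le1// (lt_le_trans _ p).
have h2 := bernoulli_sub n.+1 (expR_ge0 (- tau)) eta1.
apply: (@le_trans _ _ ((1 - expR (- tau) ^+ n.+1) * gauss 1 x)).
  by rewrite mulrBl mul1r lerD2l lerN2.
apply: (@le_trans _ _ (n.+1%:R * (1 - expR (- tau)) * (2 ^+ n * cauchy_weight x))).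
  apply: ler_pM => //; last exact: expR_ge0.
  by rewrite subr_ge0 exprn_ile1 ?expR_ge0.
by rewrite le_eqVlt; apply/orP; left; apply/eqP; ring.
Qed.

Lemma xexpRN_le (y : R) : y * expR (- y) <= 1 - expR (- y).
Proof.
rewrite -subr_ge0 (_ : _ - _ = (1 - (1 + y) * expR (- y))); last by ring.
rewrite subr_ge0 expRN ler_pdivrMr ?expR_gt0// mul1r.
exact: expR_ge1Dx.
Qed.

(** The widening of the Gaussian is first order in tau after half of the exponent
    has absorbed |x|^2; one half of exp(-tau) then pays for the width
    A = 1 + 2 tau in the product majorant, and the other half turns the factor
    tau into 1 - exp(-tau). *)
Lemma heat_sub_gauss n (tau : R) (x : 'rV[R]_n) : (0 < n)%N -> 0 < tau ->
  damped_heat 1 tau x - gauss 1 x <=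
  8 * (16 * n%:R) ^+ n * (1 - expR (- tau)) * cauchy_weight x.
Proof.
move=> n0 t0; set A := 1 + 2 * tau; set r := dot x x.
have nR : 1 <= n%:R :> R by rewrite ler1n.
have r0 : 0 <= r := dot_ge0 x.
have w0 := cauchy_weight_ge0 x.
have A1 : 1 <= A by rewrite lerDl mulr_ge0// ltW.
have A0 : 0 < A by lra.
have s0 : 0 <= (Num.sqrt A)^-1 by rewrite invr_ge0 sqrtr_ge0.
have s1 := sqrtV_le1 t0.
have h1 : damped_heat 1 tau x <= expR (- tau) * gauss A^-1 x.
  rewrite /damped_heat mulr1 div1r -/A; apply: ler_wpM2r; first exact: expR_ge0.
  by rewrite ler_piMr ?expR_ge0// exprn_ile1.
have h2 : expR (- tau) * gauss A^-1 x - gauss 1 x <=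
    expR (- tau) * (gauss A^-1 x - gauss 1 x).
  rewrite mulrBr lerD2l lerN2 ler_piMl ?expR_ge0//.
  exact: expRN_ge0_le1 (ltW t0).
pose y := r / (4 * A).
have y0 : 0 <= y by rewrite divr_ge0// mulr_ge0// ltW.
have h3 : gauss A^-1 x - gauss 1 x <= 4 * tau * expR (- y).
  have -> : gauss 1 x = gauss A^-1 x * expR (- (4 * tau * y)).
    rewrite /gauss -expRD -/r; congr expR; rewrite /y /A; field.
    by rewrite -/A gt_eqF.
  have -> : gauss A^-1 x = expR (- y) * expR (- y).
    by rewrite /gauss -expRD -/r; congr expR; rewrite /y; field; rewrite gt_eqF.
  have e1 : 1 - expR (- (4 * tau * y)) <= 4 * tau * y.
    by have := expR_ge1Dx (- (4 * tau * y)); lra.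
  have e2 : y * expR (- y) <= 1.
    by have := xexpRN_le y; have := expR_gt0 (- y); lra.
  rewrite (_ : _ - _ = expR (- y) * (expR (- y) * (1 - expR (- (4 * tau * y))))); last by ring.
  rewrite mulrC; apply: ler_wpM2r; first exact: expR_ge0.
  apply: (le_trans (ler_wpM2l (expR_ge0 _) e1)).
  rewrite [leLHS](_ : _ = 4 * tau * (y * expR (- y))); last by ring.
  by rewrite ler_piMr// mulr_ge0// ltW.
have h4 : expR (- y) <= (4 * A) ^+ n * cauchy_weight x by apply: expR_dot_le; lra.
have h5 : (4 * A) ^+ n <= (16 * n%:R) ^+ n * expR (tau / 2).
  have -> : expR (tau / 2) = expR (tau / (2 * n%:R)) ^+ n.
    by rewrite -expRM_natr; congr expR; field; lra.
  rewrite -exprMn; apply: lerXn2r; rewrite ?nnegrE.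
  - by rewrite mulr_ge0// ltW.
  - by rewrite mulr_ge0 ?expR_ge0.
  have q0 : 0 <= 16 * n%:R :> R by rewrite mulr_ge0.
  apply: (le_trans _ (ler_wpM2l q0 (expR_ge1Dx _))).
  rewrite [leRHS](_ : _ = 16 * n%:R + 8 * tau); last by field; lra.
  by rewrite /A; lra.
have h6 : tau * expR (- (tau / 2)) <= 2 * (1 - expR (- tau)).
  have := xexpRN_le (tau / 2).
  have : expR (- tau) <= expR (- (tau / 2)) by rewrite ler_expR; lra.
  by lra.
have et : expR (- tau) = expR (- (tau / 2)) * expR (- (tau / 2)).
  by rewrite -expRD; congr expR; field.
have ee : expR (- (tau / 2)) * expR (tau / 2) = 1 by rewrite -expRD addNr expR0.
apply: (@le_trans _ _ (expR (- tau) * (4 * tau * ((16 * n%:R) ^+ n * expR (tau / 2) * cauchy_weight x)))).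
  apply: (le_trans (lerB h1 (lexx _))); apply: (le_trans h2).
  apply: ler_wpM2l; first exact: expR_ge0.
  apply: (le_trans h3); apply: ler_wpM2l; first by rewrite mulr_ge0// ltW.
  by apply: (le_trans h4); apply: ler_wpM2r.
rewrite et [leLHS](_ : _ = (16 * n%:R) ^+ n * cauchy_weight x * 4 *
  ((tau * expR (- (tau / 2))) * (expR (- (tau / 2)) * expR (tau / 2)))); last by ring.
rewrite ee mulr1 -et.
rewrite [leRHS](_ : _ = (16 * n%:R) ^+ n * cauchy_weight x * 4 * (2 * (1 - expR (- tau)))); last by ring.
by apply: ler_wpM2l h6; rewrite !mulr_ge0// exprn_ge0// mulr_ge0.
Qed.

Definition decay_const n : R := n.+1%:R * 2 ^+ n + 8 * (16 * n%:R) ^+ n.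

(** The factor 1 - exp(-tau) in the two bounds above is the one in the kernel
    for lam = 1, whose integral is subord_const sg. *)
Lemma normr_bessel_gauss_le n (sg : R) (x : 'rV[R]_n) : (0 < n)%N ->
  0 < sg -> sg <= 1 / 2 ->
  `|bessel_gauss sg 1 x| <= decay_const n * subord_const sg * cauchy_weight x.
Proof.
move=> n0 sg0 sg1; have i1 := integrable_bessel_density x ltr01 sg0 sg1.
have i2 := integrable_subord_kernel1 sg0 sg1.
have i3 := integrableZl measurableT (decay_const n * cauchy_weight x) i2.
have w0 := cauchy_weight_ge0 x.
rewrite mulrAC /subord_const -RintegralZl//.
have a1 : mu.-integrable setT (EFin \o (fun u => `|bessel_density sg 1 x u|)).
  exact: integrable_norm.
apply: (le_trans (le_normr_Rintegral _ _)) => //.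
apply: le_Rintegral => // u _.
rewrite /bessel_density normrM (ger0_norm (expR_ge0 _)) /subord_kernel mul1r mulrA.
apply: ler_wpM2r; first exact: expR_ge0.
have t0 := expR_gt0 u.
have e0 : 0 <= 1 - expR (- expR u) by rewrite subr_ge0 expRN_ge0_le1// ltW.
have p1 : 0 <= n.+1%:R * 2 ^+ n * (1 - expR (- expR u)) * cauchy_weight x :> R.
  by rewrite !mulr_ge0.
have p2 : 0 <= 8 * (16 * n%:R) ^+ n * (1 - expR (- expR u)) * cauchy_weight x :> R.
  by rewrite !mulr_ge0// exprn_ge0// mulr_ge0.
have h1 := gauss_sub_heat x t0.
have h2 := heat_sub_gauss x n0 t0.
have -> : decay_const n * cauchy_weight x * (1 - expR (- expR u)) =
  n.+1%:R * 2 ^+ n * (1 - expR (- expR u)) * cauchy_weight x +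
  8 * (16 * n%:R) ^+ n * (1 - expR (- expR u)) * cauchy_weight x.
  by rewrite /decay_const; ring.
by rewrite ler_norml; apply/andP; split; lra.
Qed.

End upper_bound.

(** * Mean oscillation of Gaussians on cubes *)
Section bmo.
Context {R : realType}.
Local Notation mu := (@lebesgue_measure R).
Local Notation mR := (measurableTypeR R).

(** The integral of a nonnegative function is a supremum over the simple
    functions below it, so monotonicity holds for arbitrary functions.  In this
    form it applies to Bessel potentials as functions of the point without a
    study of their measurability. *)
Lemma ge0_le_integralT d (T : measurableType d) (m : {measure set T -> \bar R})
    (f g : T -> \bar R) :
  (forall x, 0 <= f x)%E -> (forall x, f x <= g x)%E ->
  (\int[m]_x f x <= \int[m]_x g x)%E.
Proof.
move=> f0 fg; rewrite !ge0_integralTE//; last first.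
  by move=> x; exact: le_trans (fg x).
by apply: ereal_sup_le => _ [h hf <-]; exists h => // x; exact: le_trans (fg x).
Qed.

(** The derivative of gauss1 b is sqrt b times z exp(-z^2 / 2) at z = sqrt b x,
    and z <= exp(z^2 / 2). *)
Lemma gauss1_dist (b x y : R) : 0 < b ->
  `|gauss1 b x - gauss1 b y| <= Num.sqrt b * `|x - y|.
Proof.
move=> b0; wlog xy : x y / x < y.
  move=> H; case: (ltgtP x y) => [|yx|->]; [exact: H| |].
    by rewrite distrC [`|x - y|]distrC; exact: H.
  by rewrite !subrr normr0 mulr0.
have [|c _ e] := @MVT R (gauss1 b) (fun x => - (b * x * gauss1 b x)) x y xy
   (fun z _ => is_derive_gauss1 b z).
  by apply: continuous_subspaceT; exact: continuous_gauss1.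
rewrite distrC e [`|x - y|]distrC normrM; apply: ler_wpM2r => //.
rewrite normrN !normrM (ger0_norm (gauss1_ge0 _ _)) gtr0_norm//.
pose q := Num.sqrt b; have q0 : 0 < q by rewrite sqrtr_gt0.
have bq : b = q ^+ 2 by rewrite sqr_sqrtr// ltW.
have key : q * `|c| * gauss1 b c <= 1.
  rewrite /gauss1 mulNr expRN ler_pdivrMr ?expR_gt0// mul1r.
  apply: le_trans (expR_ge1Dx _).
  rewrite bq -[c ^+ 2]real_normK ?num_real//.
  have := sqr_ge0 (q * `|c| - 1); nra.
rewrite -/q (_ : _ * _ = q * (q * `|c| * gauss1 b c)); last by rewrite {1}bq; ring.
by rewrite ler_piMr// ltW.
Qed.

Lemma prod_dist01 n (f g : 'I_n -> R) :
  (forall i, 0 <= f i <= 1) -> (forall i, 0 <= g i <= 1) ->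
  `|\prod_(i < n) f i - \prod_(i < n) g i| <= \sum_(i < n) `|f i - g i|.
Proof.
elim: n f g => [|n IH] f g f01 g01; first by rewrite !big_ord0 subrr normr0.
rewrite !big_ord_recl.
set F := \prod_(i < n) _; set G := \prod_(i < n) _.
have F01 : 0 <= F <= 1.
  apply/andP; split; last by apply: prodr_ile1.
  by apply: prodr_ge0 => i _; case/andP: (f01 (lift ord0 i)).
have /andP[g0 g1] := g01 ord0; have /andP[F0 F1] := F01.
have -> : f ord0 * F - g ord0 * G = (f ord0 - g ord0) * F + g ord0 * (F - G) by ring.
apply: (le_trans (ler_normD _ _)); rewrite !normrM (ger0_norm g0) (ger0_norm F0).
apply: lerD; first by rewrite ler_piMr.
apply: (le_trans (ler_piMl _ g1)) => //.
by apply: IH => i; [exact: f01|exact: g01].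
Qed.

Section on_cube.
Variables (m : nat) (a : 'rV[R]_m.+1) (l : R).
Hypothesis l0 : 0 < l.

Definition cubeT : set (m.+1.-tuple mR) := vec @^-1` cube a l.

Lemma cubeTE : cubeT = [set t | forall i, tnth t i \in `[a 0 i, a 0 i + l]].
Proof.
by apply/seteqP; split => t h i; have := h i; rewrite /vec mxE.
Qed.

Lemma leb_cubeT : leb m.+1 cubeT = (l ^+ m.+1)%:E.
Proof.
rewrite cubeTE (@leb_box _ _ (fun i => a 0 i) (fun i => a 0 i + l)); last first.
  by move=> i; rewrite lerDl ltW.
by under eq_bigr do rewrite addrAC subrr add0r; rewrite prodr_const card_ord.
Qed.

Lemma volume_cube : volume (cube a l) = l ^+ m.+1.
Proof. by rewrite /volume -/cubeT leb_cubeT. Qed.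

Lemma measurable_cubeT : measurable cubeT.
Proof.
rewrite cubeTE [X in measurable X](_ : _ = \bigcap_(i in [set: 'I_m.+1])
  ((fun t : m.+1.-tuple mR => tnth t i) @^-1` [set` `[a 0 i, a 0 i + l]])).
  apply: fin_bigcap_measurable => // i _.
  rewrite -[X in measurable X]setTI.
  by apply: (@measurable_tnth _ mR m.+1 i) => //; exact: measurable_itv.
by apply/seteqP; split => t /= h i; [move=> _|]; exact: h.
Qed.

Lemma integrable_cubeT (f : m.+1.-tuple mR -> R) K :
  measurable_fun setT f -> (forall t, `|f t| <= K) ->
  (leb m.+1).-integrable cubeT (EFin \o f).
Proof.
move=> mf fK.
have Doo : (leb m.+1 cubeT < +oo)%E by rewrite leb_cubeT ltry.
apply: measurable_bounded_integrable => //.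
- exact: measurable_cubeT.
- exact: measurable_funTS.
- exists K; split; first by rewrite num_real.
  by move=> M KM t _ /=; apply: (le_trans (fK t)); exact: ltW.
Qed.

Lemma Rintegral_cubeT_cst c : (\int[leb m.+1]_(t in cubeT) c)%R = c * l ^+ m.+1.
Proof.
rewrite Rintegral_cst; last exact: measurable_cubeT.
by have -> : fine (leb m.+1 cubeT) = l ^+ m.+1 by rewrite leb_cubeT.
Qed.


Lemma gauss_tuple_le1 n b (t : n.-tuple R) : 0 < b -> `|gauss_tuple b t| <= 1.
Proof.
move=> b0; rewrite ger0_norm ?gauss_tuple_ge0// /gauss_tuple mulNr.
by rewrite expRN_ge0_le1// mulr_ge0 ?sqnorm_ge0// divr_ge0// ltW.
Qed.

Lemma integrable_gauss_tuple_cube b : 0 < b ->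
  (leb m.+1).-integrable cubeT (EFin \o @gauss_tuple R m.+1 b).
Proof.
move=> b0; apply: (@integrable_cubeT _ 1); first exact: measurable_gauss_tuple.
by move=> t; exact: gauss_tuple_le1.
Qed.

Lemma gauss_tuple_osc b (t s : m.+1.-tuple mR) : 0 < b -> cubeT t -> cubeT s ->
  `|gauss_tuple b t - gauss_tuple b s| <= m.+1%:R * (Num.sqrt b * l).
Proof.
move=> b0; rewrite cubeTE => tD sD; rewrite !gauss_tupleE.
have g01 x : 0 <= gauss1 b x <= 1.
  rewrite gauss1_ge0/= /gauss1 mulNr expRN_ge0_le1// mulr_ge0 ?sqr_ge0//.
  by rewrite divr_ge0// ltW.
apply: (le_trans (prod_dist01 _ _)) => //.
rewrite -[m.+1 in leRHS]card_ord mulr_natl -sumr_const; apply: ler_sum => i _.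
apply: (le_trans (gauss1_dist _ _ b0)); apply: ler_wpM2l; first exact: sqrtr_ge0.
have := tD i; have := sD i; rewrite !in_itv/= => /andP[s1 s2] /andP[t1 t2].
by rewrite ler_norml; apply/andP; split; lra.
Qed.

Definition gmean (b : R) : R :=
  (l ^+ m.+1)^-1 * (\int[leb m.+1]_(t in cubeT) gauss_tuple b t)%R.

Lemma gmean_ge0 b : 0 <= gmean b.
Proof.
apply: mulr_ge0; first by rewrite invr_ge0 exprn_ge0// ltW.
by apply: Rintegral_ge0 => t _; exact: gauss_tuple_ge0.
Qed.

Lemma integrable_cst_cube c : (leb m.+1).-integrable cubeT (EFin \o cst c).
Proof. by apply: (@integrable_cubeT _ `|c|). Qed.

Lemma gmean_osc b (t : m.+1.-tuple mR) : 0 < b -> cubeT t ->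
  `|gauss_tuple b t - gmean b| <= m.+1%:R * (Num.sqrt b * l).
Proof.
move=> b0 tD; set L := _ * _.
have V0 : 0 < l ^+ m.+1 by rewrite exprn_gt0.
have mD := measurable_cubeT.
have ig := integrable_gauss_tuple_cube b0.
have h1 : gmean b <= gauss_tuple b t + L.
  rewrite /gmean ler_pdivrMl// mulrC -Rintegral_cubeT_cst.
  apply: le_Rintegral => //; first exact: integrable_cst_cube.
  by move=> s sD; have := gauss_tuple_osc b0 tD sD; rewrite ler_norml -/L => /andP[]; lra.
have h2 : gauss_tuple b t - L <= gmean b.
  rewrite /gmean ler_pdivlMl// mulrC -Rintegral_cubeT_cst.
  apply: le_Rintegral => //; first exact: integrable_cst_cube.
  by move=> s sD; have := gauss_tuple_osc b0 tD sD; rewrite ler_norml -/L => /andP[]; lra.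
by rewrite ler_norml; apply/andP; split; lra.
Qed.

(** Only the first coordinate is used for decay: the other factors of the
    Gaussian are replaced by 1 on the cube. *)
Lemma gmean_le b : 0 < b -> gmean b <= Num.sqrt (2 * pi) / (Num.sqrt b * l).
Proof.
move=> b0; have V0 : 0 < l ^+ m.+1 by rewrite exprn_gt0.
have mD := measurable_cubeT.
have sb0 : 0 < Num.sqrt b by rewrite sqrtr_gt0.
pose I (i : 'I_m.+1) : set R := [set` `[a 0 i, a 0 i + l]].
pose psi (i : 'I_m.+1) : R -> R := if i == ord0 then gauss1 b else \1_(I i).
pose c (i : 'I_m.+1) : R := if i == ord0 then Num.sqrt (2 * pi / b) else l.
have mI i : measurable (I i : set mR) by exact: measurable_itv.
have psi0 i x : 0 <= psi i x by rewrite /psi; case: ifP => _ //; exact: gauss1_ge0.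
have hp : (\int[leb m.+1]_t (\prod_(i < m.+1) psi i (tnth t i))%:E =
    (\prod_(i < m.+1) c i)%:E)%E.
  apply: integral_leb_prod => // i; rewrite /psi /c; case: ifP => _.
  - exact: measurable_gauss1.
  - exact: measurable_indic.
  - exact: integral_gauss1.
  - rewrite integral_indic// setIT.
    transitivity (mu ([set` `[a 0 i, a 0 i + l]] : set R)) => //.
    rewrite lebesgue_measure_itv/= lte_fin ltrDl l0.
    by rewrite -EFinD addrAC subrr add0r.
have cE : \prod_(i < m.+1) c i = Num.sqrt (2 * pi) / Num.sqrt b * l ^+ m.
  rewrite big_ord_recl /c eqxx -sqrtrV ?(ltW b0)// -sqrtrM ?mulr_ge0 ?pi_ge0//.
  by congr (_ * _); rewrite -[in RHS](card_ord m) -prodr_const; apply: eq_bigr.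
have hle : (\int[leb m.+1]_(t in cubeT) gauss_tuple b t)%R <= \prod_(i < m.+1) c i.
  rewrite -lee_fin -hp /Rintegral fineK; last first.
    by apply: integrable_fin_num => //; exact: integrable_gauss_tuple_cube.
  rewrite integral_mkcond; apply: ge0_le_integralT => t; rewrite patchE.
    by case: ifPn => // _; rewrite lee_fin gauss_tuple_ge0.
  case: ifPn => [|_]; last by rewrite lee_fin prodr_ge0.
  rewrite inE cubeTE => tD; rewrite lee_fin gauss_tupleE.
  apply: ler_prod => i _; rewrite gauss1_ge0/= /psi; case: ifP => // _.
  rewrite indicE mem_set; last exact: tD.
  rewrite /gauss1 mulNr expRN_ge0_le1// mulr_ge0 ?sqr_ge0//.
  by rewrite divr_ge0// ltW.
rewrite /gmean ler_pdivrMl//; apply: (le_trans hle); rewrite cE exprS.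
by rewrite le_eqVlt; apply/orP; left; apply/eqP; field; rewrite !gt_eqF.
Qed.

Definition osc_const : R := m.+1%:R + 2 * Num.sqrt (2 * pi).

(** saturation y - saturation (y / 2) is comparable to min(y, 1 / y); in this form
    the sum over dyadic scales telescopes. *)
Definition saturation (y : R) : R := y / (1 + y).

(** With y = sqrt b l the mean deviation is at most a multiple of y, by the
    Lipschitz bound gmean_osc, and at most twice the mean, hence a multiple
    of 1 / y, by gmean_le. *)
Lemma gmean_dev b : 0 < b ->
  (\int[leb m.+1]_(t in cubeT) `|gauss_tuple b t - gmean b|)%R <=
  l ^+ m.+1 * (6 * osc_const * (saturation (Num.sqrt b * l) - saturation (Num.sqrt b * l / 2))).
Proof.
move=> b0; set y := Num.sqrt b * l.
have y0 : 0 < y by rewrite mulr_gt0// sqrtr_gt0.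
have V0 : 0 < l ^+ m.+1 by rewrite exprn_gt0.
have mD := measurable_cubeT.
have ig := integrable_gauss_tuple_cube b0.
have ic := integrable_cst_cube (gmean b).
have id0 : (leb m.+1).-integrable cubeT
    (EFin \o (fun t : m.+1.-tuple mR => gauss_tuple b t - gmean b)).
  by apply: eq_integrable (integrableB mD ig ic).
have id := integrable_norm id0.
have p0 : 0 <= Num.sqrt (2 * pi) :> R by exact: sqrtr_ge0.
have n0 : 0 <= m.+1%:R :> R by [].
have satE : saturation y - saturation (y / 2) = y / ((1 + y) * (2 + y)).
  by rewrite /saturation; field; lra.
have h1 : (\int[leb m.+1]_(t in cubeT) `|gauss_tuple b t - gmean b|)%R <=
    l ^+ m.+1 * (m.+1%:R * y).
  rewrite [leRHS]mulrC -Rintegral_cubeT_cst.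
  apply: le_Rintegral => //; first exact: integrable_cst_cube.
  by move=> t tD; exact: gmean_osc.
have h2 : (\int[leb m.+1]_(t in cubeT) `|gauss_tuple b t - gmean b|)%R <=
    l ^+ m.+1 * (2 * Num.sqrt (2 * pi) / y).
  apply: (@le_trans _ _ (\int[leb m.+1]_(t in cubeT) (gauss_tuple b t + gmean b))%R).
    apply: le_Rintegral => //.
      by apply: eq_integrable (integrableD mD ig ic).
    move=> t _; apply: (le_trans (ler_normB _ _)).
    by rewrite !ger0_norm ?gauss_tuple_ge0// gmean_ge0.
  rewrite RintegralD// Rintegral_cubeT_cst.
  have -> : (\int[leb m.+1]_(t in cubeT) gauss_tuple b t)%R = l ^+ m.+1 * gmean b.
    by rewrite /gmean mulrA divff ?mul1r// gt_eqF.
  have := gmean_le b0; rewrite -/y => gl.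
  rewrite [leLHS](_ : _ = l ^+ m.+1 * (2 * gmean b)); last by ring.
  by rewrite ler_pM2l// -mulrA ler_pM2l.
have q0 : 0 < (1 + y) * (2 + y) by rewrite mulr_gt0//; lra.
rewrite satE /osc_const; have [y1|y1] := lerP y 1.
  have q : (1 + y) * (2 + y) <= 6 by nra.
  apply: (le_trans h1); rewrite ler_pM2l// [leRHS]mulrA ler_pdivlMr//.
  apply: (le_trans (ler_wpM2l _ q)); first by rewrite mulr_ge0// ltW.
  have : 0 <= y * Num.sqrt (2 * pi) by rewrite mulr_ge0// ltW.
  by move: (Num.sqrt _) p0 => P p0; nra.
have q : (1 + y) * (2 + y) <= 6 * (y * y) by nra.
apply: (le_trans h2); rewrite ler_pM2l// [leRHS]mulrA ler_pdivlMr//.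
rewrite mulrAC ler_pdivrMr//.
apply: (le_trans (ler_wpM2l _ q)); first by rewrite mulr_ge0.
have : 0 <= m.+1%:R * (y * y) by rewrite mulr_ge0// mulr_ge0// ltW.
by move: (Num.sqrt _) p0 => P p0; nra.
Qed.

End on_cube.
End bmo.

(** * The BMO norm of a sum of dyadic dilates of a Gaussian *)
Section bmo_gauss_sum.
Context {R : realType}.
Local Notation mR := (measurableTypeR R).

Lemma cmod_real (r : R) : cmod (r%:C) = `|r|.
Proof. by rewrite /cmod /= expr0n addr0 sqrtr_sqr. Qed.

(** Written as a square because sqrt (dyad k) = 2^-k is the inverse scale. *)
Definition dyad (k : nat) : R := (2^-1 ^+ k) ^+ 2.

Lemma dyad_gt0 k : 0 < dyad k.
Proof. by rewrite !exprn_gt0// invr_gt0. Qed.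

Lemma dyad_le1 k : dyad k <= 1.
Proof. by rewrite !exprn_ile1 ?exprn_ge0 ?invr_ge0// invf_le1// ler1n. Qed.

Lemma sqrt_dyad k : Num.sqrt (dyad k) = 2^-1 ^+ k.
Proof. by rewrite sqrtr_sqr ger0_norm// exprn_ge0// invr_ge0. Qed.

Lemma saturation_telescope (l : R) N : 0 < l ->
  \sum_(k < N) (saturation (2^-1 ^+ k * l) - saturation (2^-1 ^+ k * l / 2)) <= 1.
Proof.
move=> l0; pose f k := saturation (2^-1 ^+ k * l).
have -> : \sum_(k < N) (saturation (2^-1 ^+ k * l) - saturation (2^-1 ^+ k * l / 2)) =
    f 0%N - f N.
  elim: N => [|N IH]; first by rewrite big_ord0 subrr.
  rewrite big_ord_recr/= IH /f.
  have -> : 2^-1 ^+ N.+1 * l = 2^-1 ^+ N * l / 2 by rewrite exprS; ring.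
  by ring.
have y0 k : 0 < 2^-1 ^+ k * l by rewrite mulr_gt0// exprn_gt0// invr_gt0.
have f0 k : 0 <= f k by rewrite divr_ge0// ?addr_ge0// ltW.
have : f 0%N <= 1.
  by rewrite /f /saturation expr0 mul1r ler_pdivrMr ?addr_gt0// mul1r lerDr.
by have := f0 N; lra.
Qed.

Lemma BMO_gauss_sum m N (delta : R) : 0 <= delta ->
  (BMO_norm (fun x : 'rV[R]_m.+1 => (gauss_sum N (fun=> delta) dyad x)%:C) <=
   (delta * (6 * @osc_const R m))%:E)%E.
Proof.
move=> d0; apply: ge_ereal_sup => _ [_ [a _ [l l0' <-]] <-].
have l0 : 0 < l := l0'.
have V0 : 0 < l ^+ m.+1 by rewrite exprn_gt0.
have mD := measurable_cubeT a l.
rewrite volume_cube// -/(cubeT a l).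
pose M := \sum_(k < N) delta * gmean a l (dyad k).
have ig (k : 'I_N) : (leb m.+1).-integrable (cubeT a l)
    (EFin \o (fun t : m.+1.-tuple mR => delta * gauss_tuple (dyad k) t)).
  by apply: eq_integrable (integrableZl mD delta (integrable_gauss_tuple_cube a l0 (dyad_gt0 k))).
have avg : average (cube a l) (fun x : 'rV[R]_m.+1 => (gauss_sum N (fun=> delta) dyad x)%:C)
    = M%:C.
  rewrite /average /cintegral volume_cube// -/(cubeT a l).
  have -> : (\int[leb m.+1]_(t in cubeT a l) complex.Im
     ((gauss_sum N (fun=> delta) dyad (vec t))%:C))%R = 0.
    by rewrite /= Rintegral_cubeT_cst// mul0r.
  have -> : (\int[leb m.+1]_(t in cubeT a l) complex.Re
     ((gauss_sum N (fun=> delta) dyad (vec t))%:C))%R = l ^+ m.+1 * M.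
    rewrite /Rintegral (_ : (fun t => _) = (fun t : m.+1.-tuple mR =>
      (\sum_(k < N) delta * gauss_tuple (dyad k) t)%:E)); last first.
      by apply/funext => t; congr EFin; apply: eq_bigr => k _; rewrite gauss_vec.
    rewrite (@integral_sum_EFin _ _ _ _ _ _ _
      (fun k => l ^+ m.+1 * (delta * gmean a l (dyad k))))//=; last first.
      move=> k; under eq_integral do rewrite EFinM.
      have ik := integrable_gauss_tuple_cube a l0 (dyad_gt0 k).
      rewrite integralZl// -[X in (_ * X)%E]fineK; last exact: integrable_fin_num ik.
      rewrite -EFinM; congr EFin; rewrite /gmean mulrCA; congr (_ * _).
      by rewrite mulrA divff ?mul1r// gt_eqF.
    by rewrite mulr_sumr.
  rewrite -[(_ * M) +i* 0]/((_ * M)%:C) -rmorphM mulrA mulVf ?mul1r// gt_eqF//.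
rewrite avg.
have idev (k : 'I_N) : (leb m.+1).-integrable (cubeT a l)
   (EFin \o (fun t : m.+1.-tuple mR => `|gauss_tuple (dyad k) t - gmean a l (dyad k)|)).
  have id0 : (leb m.+1).-integrable (cubeT a l)
     (EFin \o (fun t : m.+1.-tuple mR => gauss_tuple (dyad k) t - gmean a l (dyad k))).
    by apply: eq_integrable (integrableB mD
      (integrable_gauss_tuple_cube a l0 (dyad_gt0 k)) (integrable_cst_cube a l0 _)).
  exact: integrable_norm.
pose I (k : 'I_N) := (\int[leb m.+1]_(t in cubeT a l)
   `|gauss_tuple (dyad k) t - gmean a l (dyad k)|)%R.
have le1 : (\int[leb m.+1]_(t in cubeT a l)
    (cmod ((gauss_sum N (fun=> delta) dyad (vec t))%:C - M%:C))%:E <=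
    (\sum_(k < N) delta * I k)%:E)%E.
  rewrite -(@integral_sum_EFin _ _ _ (leb m.+1) (cubeT a l) N (fun k t =>
      delta * `|gauss_tuple (dyad k) t - gmean a l (dyad k)|) (fun k => delta * I k))//; last 2 first.
  - move=> k.
    by apply: eq_integrable (integrableZl mD delta (idev k)).
  - move=> k; under eq_integral do rewrite EFinM.
    rewrite integralZl//; last exact: idev.
    rewrite EFinM /I /Rintegral fineK//.
    by apply: integrable_fin_num => //; exact: idev.
  rewrite !(integral_mkcond (cubeT a l)); apply: ge0_le_integralT => t.
    rewrite patchE; case: ifPn => // _; rewrite lee_fin -rmorphB cmod_real//.
  rewrite !patchE; case: ifPn => // _; rewrite lee_fin -rmorphB cmod_real.
  rewrite /gauss_sum /M -sumrB; apply: (le_trans (ler_norm_sum _ _ _)).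
  apply: ler_sum => k _; rewrite gauss_vec -mulrBr normrM ger0_norm//.
apply: (le_trans (lee_wpmul2l _ le1)).
  by rewrite lee_fin invr_ge0 ltW.
rewrite -EFinM lee_fin ler_pdivrMl//.
apply: (@le_trans _ _ (\sum_(k < N) delta * (l ^+ m.+1 * (6 * @osc_const R m *
   (saturation (2^-1 ^+ k * l) - saturation (2^-1 ^+ k * l / 2)))))).
  apply: ler_sum => k _; apply: ler_wpM2l => //.
  by have := gmean_dev a l0 (dyad_gt0 k); rewrite sqrt_dyad.
have -> : \sum_(k < N) delta * (l ^+ m.+1 * (6 * @osc_const R m *
   (saturation (2^-1 ^+ k * l) - saturation (2^-1 ^+ k * l / 2)))) =
  l ^+ m.+1 * (delta * (6 * @osc_const R m)) *
  \sum_(k < N) (saturation (2^-1 ^+ k * l) - saturation (2^-1 ^+ k * l / 2)).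
  by rewrite mulr_sumr; apply: eq_bigr => k _; ring.
apply: ler_piMr; last exact: saturation_telescope.
have p0 : 0 <= @osc_const R m by rewrite addr_ge0// mulr_ge0// sqrtr_ge0.
by rewrite !mulr_ge0// ltW.
Qed.

End bmo_gauss_sum.

(** * Gaussian sums are Schwartz functions *)
Section schwartz_gauss.
Context {R : realType} {n : nat}.
Local Notation V := 'rV[R]_n.

(** Polynomial expressions: a class of coefficients, closed under formal partial
    derivatives, for which polynomial growth is seen by structural induction. *)
Inductive pexp :=
  PCst of R | PVar of 'I_n | PAdd of pexp & pexp | PMul of pexp & pexp.

Fixpoint peval (p : pexp) (x : V) : R :=
  match p with
  | PCst c => c
  | PVar i => x 0 i
  | PAdd p q => peval p x + peval q x
  | PMul p q => peval p x * peval q x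
  end.

Fixpoint pder (i : 'I_n) (p : pexp) : pexp :=
  match p with
  | PCst c => PCst 0
  | PVar j => PCst (i == j)%:R
  | PAdd p q => PAdd (pder i p) (pder i q)
  | PMul p q => PAdd (PMul p (pder i q)) (PMul (pder i p) q)
  end.

(** Directional derivative together with full differentiability, the form in
    which smoothness requires it. *)
Definition has_dir (f : V -> R) (x v : V) (df : R) :=
  differentiable f x /\ 'D_v f x = df.

Lemma has_dir_cst c x v : has_dir (fun=> c) x v 0.
Proof. by split; [exact: differentiable_cst|exact: derive_cst]. Qed.

Lemma has_dir_coord (i : 'I_n) (x v : V) : has_dir (fun y : V => y 0 i) x v (v 0 i).
Proof.
have d : differentiable (fun y : V => y 0 i) x by exact: differentiable_coord.
split => //.
apply: cvg_lim => //; apply: cvg_near_cst.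
near=> h; rewrite /= !mxE addrK /GRing.scale/= mulrA mulVf ?mul1r//.
by near: h; exact: nbhs_dnbhs_neq.
Unshelve. all: by end_near. Qed.

Lemma has_dirD f g x v df dg : has_dir f x v df -> has_dir g x v dg ->
  has_dir (fun y => f y + g y) x v (df + dg).
Proof.
move=> [f1 f2] [g1 g2]; split; first exact: differentiableD.
by rewrite deriveD ?f2 ?g2//; exact: diff_derivable.
Qed.

Lemma has_dirM f g x v df dg : has_dir f x v df -> has_dir g x v dg ->
  has_dir (fun y => f y * g y) x v (f x * dg + df * g x).
Proof.
move=> [f1 f2] [g1 g2]; split; first exact: differentiableM.
rewrite deriveM ?f2 ?g2; [|exact: diff_derivable|exact: diff_derivable].
by rewrite /GRing.scale/= [df * _]mulrC.
Qed.

Lemma has_dir_expR f x v df : has_dir f x v df ->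
  has_dir (fun y => expR (f y)) x v (expR (f x) * df).
Proof.
move=> [f1 f2].
have e1 : differentiable (@expR R) (f x) by exact/derivable1_diffP/derivable_expR.
have c1 : differentiable (expR \o f) x by exact: differentiable_comp.
split => //; rewrite deriveE// diff_comp//= -(deriveE _ f1) f2.
rewrite diff1E//= /GRing.scale/= mulrC; congr (_ * _).
by rewrite derive1E; case: (is_derive_expR (f x)).
Qed.

Lemma has_dir_sum N (F dF : 'I_N -> V -> R) x v :
  (forall k, has_dir (F k) x v (dF k x)) ->
  has_dir (fun y => \sum_(k < N) F k y) x v (\sum_(k < N) dF k x).
Proof.
elim: N F dF => [|N IH] F dF h.
  rewrite big_ord0 (_ : (fun y => _) = fun=> 0); first exact: has_dir_cst.
  by apply/funext => y; rewrite big_ord0.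
rewrite big_ord_recr/= (_ : (fun y => _) =
  fun y => \sum_(k < N) F (widen_ord (leqnSn N) k) y + F ord_max y); last first.
  by apply/funext => y; rewrite big_ord_recr.
apply: has_dirD; last exact: h.
by apply: (IH _ (fun k => dF (widen_ord (leqnSn N) k))) => k; exact: h.
Qed.

Lemma has_dir_peval p x i : has_dir (peval p) x (delta_mx 0 i) (peval (pder i p) x).
Proof.
elim: p => [c|j|p IHp q IHq|p IHp q IHq] /=.
- exact: has_dir_cst.
- by have := has_dir_coord j x (delta_mx 0 i); rewrite mxE eqxx/= eq_sym.
- exact: has_dirD.
- exact: has_dirM.
Qed.

Lemma has_dir_gauss b x i :
  has_dir (gauss b) x (delta_mx 0 i) (- (b * x 0 i) * gauss b x).
Proof.
have h (j : 'I_n) : has_dir (fun y : V => y 0 j * y 0 j) x (delta_mx 0 i)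
    (2 * x 0 j * (i == j)%:R).
  have c := has_dir_coord j x (delta_mx 0 i).
  have := has_dirM c c; rewrite mxE eqxx/= eq_sym.
  by rewrite (_ : _ + _ = 2 * x 0 j * (i == j)%:R); last ring.
have hd := @has_dir_sum _ _ (fun j x => 2 * x 0 j * (i == j)%:R) x _ h.
have := has_dir_expR (has_dirM (has_dir_cst (- (b / 2)) x (delta_mx 0 i)) hd).
rewrite (_ : expR _ * _ = - (b * x 0 i) * gauss b x)//.
have -> : \sum_(j < n) 2 * x 0 j * (i == j)%:R = 2 * x 0 i.
  rewrite (bigD1 i) //= big1 => [|j ij]; first by rewrite eqxx addr0 mulr1.
  by rewrite eq_sym (negbTE ij) mulr0.
by rewrite -/(gauss b x); field.
Qed.

Definition pgauss N (P : nat -> pexp) (b : nat -> R) (x : V) : R :=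
  \sum_(k < N) peval (P k) x * gauss (b k) x.

(** The polynomial factors after one partial derivative: the exponential of the
    k-th term contributes the factor - b k x_i. *)
Definition pgder (b : nat -> R) (i : 'I_n) (P : nat -> pexp) (k : nat) : pexp :=
  PAdd (PMul (P k) (PMul (PCst (- b k)) (PVar i))) (pder i (P k)).

Lemma has_dir_pgauss N P b x i :
  has_dir (pgauss N P b) x (delta_mx 0 i) (pgauss N (pgder b i P) b x).
Proof.
apply: (@has_dir_sum N (fun k x => peval (P k) x * gauss (b k) x)
  (fun k x => peval (pgder b i P k) x * gauss (b k) x)) => k.
have := has_dirM (has_dir_peval (P k) x i) (has_dir_gauss (b k) x i).
by rewrite (_ : _ + _ = peval (pgder b i P k) x * gauss (b k) x)//=; ring.
Qed.

Lemma partial_pgauss N P b i :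
  partial i (fun x : V => (pgauss N P b x)%:C) =
  (fun x : V => (pgauss N (pgder b i P) b x)%:C).
Proof.
apply/funext => x; rewrite /partial.
have -> : (@complex.Re R \o (fun x : V => (pgauss N P b x)%:C)) = pgauss N P b by [].
have -> : (@complex.Im R \o (fun x : V => (pgauss N P b x)%:C)) = fun=> 0 by [].
by rewrite (has_dir_pgauss N P b x i).2 (has_dir_cst 0 x _).2.
Qed.

(** Sums of polynomials times Gaussians are stable under differentiation, so
    smoothness and decay only have to be checked for sums of this form. *)
Lemma partials_pgauss N P b s :
  partials s (fun x : V => (pgauss N P b x)%:C) =
  (fun x : V => (pgauss N (foldr (pgder b) P s) b x)%:C).
Proof.
by elim: s => [//|i s IH]; rewrite /partials/= -/(partials s _) IH partial_pgauss.
Qed.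

Definition poly_bounded (f : V -> R) :=
  exists C m, forall x, `|f x| <= C * (1 + dot x x) ^+ m.

Lemma dot1_ge1 (x : V) : 1 <= 1 + dot x x.
Proof. by rewrite lerDl dot_ge0. Qed.

Lemma poly_bounded_cst c : poly_bounded (fun=> c).
Proof. by exists `|c|, 0%N => x; rewrite expr0 mulr1. Qed.

Lemma poly_bounded_coord i : poly_bounded (fun x : V => x 0 i).
Proof.
exists 1, 1%N => x; rewrite expr1 mul1r.
have : x 0 i ^+ 2 <= dot x x.
  rewrite /dot (bigD1 i)//= -expr2 lerDl; apply: sumr_ge0 => j _.
  by rewrite -expr2 sqr_ge0.
rewrite -[x 0 i ^+ 2]real_normK ?num_real// => h.
have := sqr_ge0 (`|x 0 i| - 1); nra.
Qed.

Lemma poly_bounded_ge0 f : poly_bounded f ->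
  exists C m, 0 <= C /\ forall x, `|f x| <= C * (1 + dot x x) ^+ m.
Proof.
move=> [C [m h]]; exists `|C|, m; split => // x; apply: (le_trans (h x)).
by rewrite ler_wpM2r ?ler_norm// exprn_ge0// (le_trans _ (dot1_ge1 x)).
Qed.

Lemma poly_boundedM f g : poly_bounded f -> poly_bounded g ->
  poly_bounded (fun x => f x * g x).
Proof.
move=> /poly_bounded_ge0[C [m [C0 h]]] /poly_bounded_ge0[D [k [D0 hg]]].
exists (C * D), (m + k)%N => x.
by rewrite normrM exprD mulrACA ler_pM.
Qed.

Lemma poly_boundedD f g : poly_bounded f -> poly_bounded g ->
  poly_bounded (fun x => f x + g x).
Proof.
move=> /poly_bounded_ge0[C [m [C0 h]]] /poly_bounded_ge0[D [k [D0 hg]]].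
exists (C + D), (m + k)%N => x; have x1 := dot1_ge1 x.
apply: (le_trans (ler_normD _ _)); rewrite mulrDl; apply: lerD.
- by apply: (le_trans (h x)); rewrite ler_wpM2l// ler_weXn2l// leq_addr.
- by apply: (le_trans (hg x)); rewrite ler_wpM2l// ler_weXn2l// leq_addl.
Qed.

Lemma poly_bounded_peval p : poly_bounded (peval p).
Proof.
elim: p => [c|j|p IHp q IHq|p IHp q IHq] /=.
- exact: poly_bounded_cst.
- exact: poly_bounded_coord.
- exact: poly_boundedD.
- exact: poly_boundedM.
Qed.

Lemma poly_bounded_monomial (a : 'I_n -> nat) : poly_bounded (monomial a).
Proof.
rewrite /monomial; elim: (index_enum _) => [|i s IH].
  by under eq_fun do rewrite big_nil; exact: poly_bounded_cst.
under eq_fun do rewrite big_cons; apply: poly_boundedM => //.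
elim: (a i) => [|m IHm]; first by under eq_fun do rewrite expr0; exact: poly_bounded_cst.
under eq_fun do rewrite exprS; apply: poly_boundedM => //.
exact: poly_bounded_coord.
Qed.

(** (1 + r)^(m+1) is compared with exp (b r / 2) = exp (q r)^(m+1) factor by
    factor, q = b / (2 (m + 1)). *)
Lemma poly_gauss_bounded f b : 0 < b -> poly_bounded f ->
  exists K, forall x, `|f x * gauss b x| <= K.
Proof.
move=> b0 /poly_bounded_ge0[C [m [C0 h]]].
pose q : R := b / (2 * m.+1%:R); have q0 : 0 < q by rewrite divr_gt0// mulr_gt0.
exists (C * (1 + q^-1) ^+ m.+1) => x.
have x1 := dot1_ge1 x; have r0 := dot_ge0 x.
rewrite normrM [`|gauss _ _|]ger0_norm ?expR_ge0//.
apply: (le_trans (ler_wpM2r (expR_ge0 _) (h x))); rewrite -mulrA ler_wpM2l//.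
rewrite /gauss mulNr expRN ler_pdivrMr ?expR_gt0//.
have -> : expR (b / 2 * dot x x) = expR (q * dot x x) ^+ m.+1.
  rewrite -expRM_natr; congr expR; rewrite /q; field.
  by have : 0 <= m%:R :> R by []; lra.
rewrite -exprMn; apply: (@le_trans _ _ ((1 + dot x x) ^+ m.+1)).
  exact: ler_weXn2l.
have i0 : 0 < q^-1 by rewrite invr_gt0.
apply: lerXn2r; rewrite ?nnegrE ?mulr_ge0 ?expR_ge0//; try lra.
have i1 : 0 <= 1 + q^-1 by lra.
apply: (le_trans _ (ler_wpM2l i1 (expR_ge1Dx _))).
have -> : (1 + q^-1) * (1 + q * dot x x) = 1 + dot x x + q^-1 + q * dot x x.
  by field; rewrite gt_eqF.
have : 0 <= q * dot x x by rewrite mulr_ge0// ltW.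
by lra.
Qed.

Lemma schwartz_pgauss N P b (i0 : 'I_n) : (forall k, 0 < b k) ->
  schwartz (fun x : V => (pgauss N P b x)%:C).
Proof.
move=> b0; split=> [s x|a s].
  rewrite partials_pgauss; split; last exact: differentiable_cst.
  exact: (has_dir_pgauss N _ b x i0).1.
rewrite partials_pgauss; set Q := foldr _ _ _.
have hk (k : nat) : exists K, forall x, `|(monomial a x * peval (Q k) x) * gauss (b k) x| <= K.
  apply: poly_gauss_bounded => //; apply: poly_boundedM.
    exact: poly_bounded_monomial.
  exact: poly_bounded_peval.
have [K hK] := choice hk.
exists (\sum_(k < N) K k) => x.
rewrite -rmorphM cmod_real /pgauss mulr_sumr.
apply: (le_trans (ler_norm_sum _ _ _)); apply: ler_sum => k _.
by rewrite mulrA; exact: hK.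
Qed.

End schwartz_gauss.

(** * Norm estimates and the counterexample *)
Section lp.
Context {R : realType}.
Local Notation mu := (@lebesgue_measure R).
Local Notation mR := (measurableTypeR R).

Definition cauchy_mass n : R := (\int[mu]_x (1 + x ^+ 2)^-1)%R ^+ n.

Lemma integral_cauchy_weight n :
  (\int[leb n]_t (cauchy_weight (vec t))%:E = (cauchy_mass n)%:E)%E.
Proof.
have -> : cauchy_mass n = \prod_(i < n) (\int[mu]_x (1 + x ^+ 2)^-1)%R.
  by rewrite prodr_const card_ord.
rewrite -(@integral_leb_prod _ n (fun=> fun x => (1 + x ^+ 2)^-1)).
- apply: eq_integral => t _; congr EFin; apply: eq_bigr => i _.
  by rewrite mxE.
- move=> i; have /integrableP[/measurable_EFinP//] := @integrable_oneDsqrV R.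
- by move=> i x; rewrite invr_ge0 addr_ge0// sqr_ge0.
- move=> i; rewrite /Rintegral fineK//; apply: integrable_fin_num => //.
  exact: integrable_oneDsqrV.
Qed.

Lemma cauchy_mass_ge0 n : 0 <= cauchy_mass n.
Proof.
by apply: exprn_ge0; apply: Rintegral_ge0 => x _; rewrite invr_ge0 addr_ge0// sqr_ge0.
Qed.

Lemma cauchy_weight_le1 n (x : 'rV[R]_n) : cauchy_weight x <= 1.
Proof.
apply: prodr_ile1 => i _.
have h : 1 <= 1 + x 0 i ^+ 2 by rewrite lerDl sqr_ge0.
have h0 : 0 < 1 + x 0 i ^+ 2 by exact: lt_le_trans h.
by rewrite invr_ge0 ltW//= invf_le1.
Qed.

Lemma powR_le_id (y p : R) : 0 <= y -> y <= 1 -> 1 < p -> y `^ p <= y.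
Proof.
move=> y0 y1 p1; have [->|yn] := eqVneq y 0.
  by rewrite powR0// gt_eqF// (lt_trans _ p1).
by apply: ge1r_powR; [rewrite lt_neqAle eq_sym yn y0|exact: ltW].
Qed.

Lemma normr_cmod (z : R[i]) : `|cmod z| = cmod z.
Proof. by rewrite ger0_norm// /cmod; case: z => x y /=; exact: sqrtr_ge0. Qed.

(** The product majorant is at most 1, so its p-th power is at most itself. *)
Lemma Lpnorm_ub n (p A : R) (F : 'rV[R]_n -> R[i]) : 1 < p -> 0 <= A ->
  (forall x, cmod (F x) <= A * cauchy_weight x) ->
  (Lpnorm p F <= (A * cauchy_mass n `^ p^-1)%:E)%E.
Proof.
move=> p1 A0 hF; have p0 : 0 < p by exact: lt_trans p1.
rewrite /Lpnorm unlock.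
have le1 : (\int[leb n]_t `|(cmod (F (vec t)))%:E| `^ p <=
    (A `^ p * cauchy_mass n)%:E)%E.
  rewrite EFinM -integral_cauchy_weight -ge0_integralZl//=; last 3 first.
  - apply/measurable_EFinP.
    rewrite (_ : (fun t => _) = fun t : n.-tuple mR => \prod_(i < n) (1 + (tnth t i) ^+ 2)^-1).
      apply: (@measurable_prod_tnth _ _ (fun=> fun x => (1 + x ^+ 2)^-1)) => i.
      by have /integrableP[/measurable_EFinP//] := @integrable_oneDsqrV R.
    by apply/funext => t; apply: eq_bigr => i _; rewrite mxE.
  - by move=> t _; rewrite lee_fin cauchy_weight_ge0.
  - by rewrite lee_fin powR_ge0.
  apply: ge0_le_integralT => t; first by rewrite lee_fin powR_ge0.
  have w0 := cauchy_weight_ge0 (vec t); have w1 := cauchy_weight_le1 (vec t).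
  rewrite -EFinM lee_fin normr_cmod.
  apply: (@le_trans _ _ ((A * cauchy_weight (vec t)) `^ p)).
    apply: (ge0_ler_powR (ltW p0)); rewrite ?nnegrE ?mulr_ge0//.
    by rewrite -normr_cmod.
  by rewrite powRM// ler_wpM2l ?powR_ge0// powR_le_id.
apply: (@le_trans _ _ ((A `^ p * cauchy_mass n)%:E `^ p^-1)%E).
  apply: gt0_ler_poweR => //; first by rewrite invr_ge0 ltW.
  - by rewrite in_itv/= leey andbT integral_ge0// => t _; exact: poweR_ge0.
  - by rewrite in_itv/= leey andbT lee_fin mulr_ge0 ?powR_ge0 ?cauchy_mass_ge0.
rewrite poweR_EFin powRM ?powR_ge0 ?cauchy_mass_ge0//.
by rewrite -powRrM mulfV ?gt_eqF// powRr1.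
Qed.

(** The cube on which F is bounded below has volume 1, so the estimate does not
    depend on p. *)
Lemma Lpnorm_lb m (p A : R) (F : 'rV[R]_m.+1 -> R[i]) : 0 < p -> 0 <= A ->
  (forall x : 'rV[R]_m.+1, (forall i, - (1 / 2) <= x 0 i <= 1 / 2) -> A <= cmod (F x)) ->
  (A%:E <= Lpnorm p F)%E.
Proof.
move=> p0 A0 hF; rewrite /Lpnorm unlock.
pose a : 'rV[R]_m.+1 := \row_i (- (1 / 2)).
have mD := measurable_cubeT a 1.
have V1 : leb m.+1 (cubeT a 1) = 1%E by rewrite leb_cubeT// expr1n.
have le1 : ((A `^ p)%:E <= \int[leb m.+1]_t `|(cmod (F (vec t)))%:E| `^ p)%E.
  have -> : ((A `^ p)%:E = \int[leb m.+1]_(t in cubeT a 1) (A `^ p)%:E)%E.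
    rewrite integral_cst// -[LHS]mule1; congr (_ * _)%E.
    by apply: esym; exact: V1.
  rewrite integral_mkcond; apply: ge0_le_integralT => t; rewrite patchE.
    by case: ifPn => // _; rewrite lee_fin powR_ge0.
  case: ifPn => [|_]; last exact: poweR_ge0.
  rewrite inE cubeTE => tD; rewrite abse_EFin poweR_EFin lee_fin normr_cmod.
  apply: (ge0_ler_powR (ltW p0)); rewrite ?nnegrE//; first by rewrite -normr_cmod.
  apply: hF => i; have := tD i; rewrite !mxE in_itv/=.
  by move=> /andP[t1 t2]; apply/andP; split; lra.
apply: (@le_trans _ _ ((A `^ p)%:E `^ p^-1)%E).
  by rewrite poweR_EFin -powRrM mulfV ?gt_eqF// powRr1.
apply: gt0_ler_poweR => //; first by rewrite invr_ge0 ltW.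
- by rewrite in_itv/= leey andbT lee_fin powR_ge0.
- by rewrite in_itv/= leey andbT integral_ge0// => t _; exact: poweR_ge0.
Qed.

Lemma schwartz_gauss_sum m N (c b : nat -> R) : (forall k, 0 < b k) ->
  schwartz (fun x : 'rV[R]_m.+1 => (gauss_sum N c b x)%:C).
Proof.
by move=> b0; exact: (@schwartz_pgauss _ _ N (fun k => PCst (c k)) b ord0 b0).
Qed.

Lemma dot_box m (x : 'rV[R]_m) : (forall i, - (1 / 2) <= x 0 i <= 1 / 2) ->
  dot x x <= m%:R / 4.
Proof.
move=> h; rewrite -[m in leRHS]card_ord mulr_natl -sumr_const; apply: ler_sum => i _.
by have /andP[h1 h2] := h i; nra.
Qed.

(** A product of two Gaussians is a Gaussian, so fg is again a Gaussian sum and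
    the formula for Bessel potentials applies to it. *)
Lemma bessel_commutator m N (s eta delta : R) (x : 'rV[R]_m.+1) : 0 < s -> s <= 1 ->
  let f := fun y : 'rV[R]_m.+1 => (gauss_sum 1 (fun=> eta) (fun=> 1) y)%:C in
  let g := fun y : 'rV[R]_m.+1 => (gauss_sum N (fun=> delta) dyad y)%:C in
  bessel s (fun y => f y * g y) x - f x * bessel s g x =
  ((subord_const (s / 2))^-1 * (eta * delta) * \sum_(k < N)
     (bessel_gauss (s / 2) (1 + dyad k) x - gauss 1 x * bessel_gauss (s / 2) (dyad k) x))%:C.
Proof.
move=> s0 s1 f g.
have -> : (fun y => f y * g y) = (fun y : 'rV[R]_m.+1 =>
    (gauss_sum N (fun=> eta * delta) (fun k => 1 + dyad k) y)%:C).
  apply/funext => y; rewrite /f /g -rmorphM; congr (_%:C).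
  rewrite /gauss_sum big_ord1 mulr_sumr; apply: eq_bigr => k _.
  have -> : gauss (1 + dyad k) y = gauss 1 y * gauss (dyad k) y.
    by rewrite /gauss -expRD; congr expR; ring.
  by ring.
rewrite bessel_gauss_sum//; last by move=> k; rewrite addr_gt0// dyad_gt0.
rewrite bessel_gauss_sum//; last by move=> k; exact: dyad_gt0.
rewrite /f -rmorphM -rmorphB; congr (_%:C); rewrite /gauss_sum big_ord1.
rewrite -!mulr_sumr sumrB -mulr_sumr; ring.
Qed.

Lemma Lpnorm_bessel_gauss m (s p eta : R) : 0 < s -> s <= 1 -> 1 < p -> 0 <= eta ->
  (Lpnorm p (bessel s (fun y : 'rV[R]_m.+1 => (gauss_sum 1 (fun=> eta) (fun=> 1%R) y)%:C)) <=
   (eta * (decay_const m.+1 * cauchy_mass m.+1 `^ p^-1))%R%:E)%E.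
Proof.
move=> s0 s1 p1 e0; rewrite mulrA.
have sg0 : 0 < s / 2 by rewrite divr_gt0.
have sg1 : s / 2 <= 1 / 2 by lra.
have K0 := subord_const_gt0 sg0 sg1.
have u0 : 0 <= decay_const m.+1 :> R.
  by rewrite addr_ge0// mulr_ge0// exprn_ge0// mulr_ge0.
apply: Lpnorm_ub => //; first by rewrite mulr_ge0.
move=> x; rewrite bessel_gauss_sum// cmod_real big_ord1.
rewrite normrM normrM (ger0_norm e0) gtr0_norm ?invr_gt0// ler_pdivrMl//.
have h := normr_bessel_gauss_le x (ltn0Sn m) sg0 sg1.
apply: (le_trans (ler_wpM2l e0 h)).
by rewrite le_eqVlt; apply/orP; left; apply/eqP; ring.
Qed.

End lp.

Unset Implicit Arguments.

Theorem proposition7p3 (R : realType) (d : nat) (s p : R)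
  (hd : (1 <= d)%N) (hs0 : 0 < s) (hs1 : s <= 1) (hp : 1 < p)
  (M : R) (hM : 0 < M) :
  exists f g : 'rV[R]_d -> R[i],
    [/\ schwartz f, schwartz g,
        (Lpnorm p (bessel s f) + BMO_norm g <= 1)%E &
        (M%:E < Lpnorm p (fun x : 'rV[R]_d =>
           bessel s (fun y : 'rV[R]_d => f y * g y)%R x - f x * bessel s g x)%R)%E].
Proof.
case: d hd => [//|m] _.
have sg0 : 0 < s / 2 by rewrite divr_gt0.
have sg1 : s / 2 <= 1 / 2 by lra.
have K0 := subord_const_gt0 sg0 sg1.
pose B : R := decay_const m.+1 * cauchy_mass m.+1 `^ p^-1.
have B0 : 0 <= B.
  rewrite mulr_ge0 ?powR_ge0// addr_ge0// mulr_ge0// exprn_ge0// mulr_ge0//.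
pose O : R := 6 * @osc_const R m.
have O0 : 0 < O by rewrite mulr_gt0// ltr_wpDr// mulr_ge0// sqrtr_ge0.
(* eta and delta make each of the two norms at most 1 / 2 *)
pose eta : R := (2 * (B + 1))^-1.
pose delta : R := (2 * O)^-1.
have eta0 : 0 < eta by rewrite invr_gt0 mulr_gt0//; lra.
have delta0 : 0 < delta by rewrite invr_gt0 mulr_gt0.
pose c : R := (subord_const (s / 2))^-1 * (eta * delta) * gap_const m.+1.
have c0 : 0 < c.
  apply: mulr_gt0; last exact: gap_const_gt0.
  by apply: mulr_gt0; [rewrite invr_gt0|exact: mulr_gt0].
pose N := Num.bound (M / c).
have NM : M < c * N%:R.
  by rewrite mulrC -ltr_pdivrMr//; apply: archi_boundP; rewrite divr_ge0// ltW.
exists (fun y => (gauss_sum 1 (fun=> eta) (fun=> 1) y)%:C),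
  (fun y => (gauss_sum N (fun=> delta) dyad y)%:C); split.
- exact: schwartz_gauss_sum.
- by apply: schwartz_gauss_sum; exact: dyad_gt0.
- have h1 := Lpnorm_bessel_gauss m hs0 hs1 hp (ltW eta0).
  have h2 := BMO_gauss_sum m N (ltW delta0).
  apply: (le_trans (leeD h1 h2)); rewrite -EFinD lee_fin -/B -/O.
  have -> : delta * O = 2^-1 by rewrite /delta; field; rewrite gt_eqF.
  have : eta * B <= 2^-1.
    rewrite /eta ler_pdivrMl ?mulr_gt0//; lra.
  by lra.
- apply: (@lt_le_trans _ _ (c * N%:R)%:E); first by rewrite lte_fin.
  apply: Lpnorm_lb; [exact: lt_trans hp|by rewrite mulr_ge0// ltW|].
  move=> x xbox; rewrite bessel_commutator// cmod_real.
  apply: le_trans (ler_norm _); rewrite /c -[leLHS]mulrA; apply: ler_wpM2l.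
    by apply/ltW/mulr_gt0; [rewrite invr_gt0|exact: mulr_gt0].
  rewrite mulr_natr -[N in leLHS]card_ord -sumr_const; apply: ler_sum => k _.
  by apply: bessel_gauss_gap => //; [exact: dyad_gt0|exact: dyad_le1|exact: dot_box].
Qed.
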